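(* Let $E$ be a finite directed graph. Let $v\in E^0$ be a vertex with $\beta_v>0$, and let $C_0\in\pi(E)$ be the strongly connected component containing $v$. Then the following hold. (1) The weak*-limit $\varphi_v:=\lim_{\beta\to\beta_v+0}\varphi_{\beta,v}$ exists. (2) Let $$\varphi_v=\sum_{C\in\pi_{v,\mathrm{mc}}(E)}\lambda_C\,\psi_C$$ be the decomposition of $\varphi_v$ into a convex combination of extremal KMS$_{\beta_v}$ states. Then, for $C\in\pi_{v,\mathrm{mc}}(E)$, $\lambda_C>0$ if and only if there exists a maximal path $\mu\in CB^*C_0$, where $B=B(E,C_0)$.
   Context: Graphs. A directed graph $E=(E^0,E^1,s,r)$ has vertices $E^0$, edges $E^1$, and source and range maps $s,r:E^1\to E^0$; it is finite if $E^0,E^1$ are finite. A finite path of length $|\mu|=n$ is $\mu=e_0\cdots e_{n-1}$ with $e_i\in E^1$ and $r(e_i)=s(e_{i+1})$; vertices are paths of length $0$; $E^*$ is the set of finite paths. $wE^*v$ is the set of finite paths from $w$ to $v$, $E^*v$ the set of finite paths ending at $v$; for sets $S,T$ of vertices, $SE^*T$ denotes the finite paths from a vertex of $S$ to a vertex of $T$ (same notation for other graphs, and with a vertex in place of a set). The strongly connected components (called components) are the classes of $E^0$ under $v\sim w$ iff $vE^*w\ne\emptyset$ and $wE^*v\neq\emptyset$; $\pi(E)$ is the set of components. $A_E=[|vE^1w|]_{v,w\in E^0}$ is the adjacency matrix; $A_{S,T}$ is its $S\times T$ block and $A_S=A_{S,S}$. $\rho(\cdot)$ is the spectral radius. Algebra.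 The Toeplitz algebra $\mathcal TC^*(E)$ is the universal C*-algebra generated by mutually orthogonal projections $p_v$ ($v\in E^0$) and partial isometries $s_e$ ($e\in E^1$) with $s_e^*s_e=p_{r(e)}$, $(s_es_e^* )(s_fs_f^* )=0$ for $e\ne f$, and $\sum_{e\in vE^1}s_es_e^*\le p_v$. Put $\delta_v=p_v-\sum_{e\in vE^1}s_es_e^*$ and $s_\mu=s_{e_0}\cdots s_{e_{n-1}}$ (with $s_v=p_v$ for vertices). KMS states are with respect to the gauge action $\alpha_t(p_v)=p_v$, $\alpha_t(s_e)=e^{it}s_e$ ($t\in\mathbb R$), at inverse temperatures $\beta>0$. A KMS$_\beta$ state (or positive functional) $\varphi$ is supported in $E^\infty$ if $\varphi(\delta_v)=0$ for all $v\in E^0$. Type I states. $Z_{w,v}(\beta)=\sum_{\nu\in wE^*v}e^{-\beta|\nu|}$, $Z_v(\beta)=\sum_{\nu\in E^*v}e^{-\beta|\nu|}$, and $\beta_v=\inf\{\beta\in\mathbb R: Z_v(\beta)<\infty\}$. For $\beta>0$ with $\beta>\beta_v$, $\varphi_{\beta,v}$ is the extremal type I KMS$_\beta$ state attached to $v$; it is the unique KMS$_\beta$ state with $\varphi_{\beta,v}(p_w)=Z_{w,v}(\beta)/Z_v(\beta)$ for all $w\in E^0$ (explicitly, $\varphi_{\beta,v}(s_\mu s_\nu^* )=0$ if $\mu\neq\nu$ and $\varphi_{\beta,v}(s_\mu s_\mu^* )=e^{-\beta|\mu|}\varphi_{\beta,v}(p_{r(\mu)})$). Type III states. A component $C$ is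 minimal if $\rho(A_{C'})<\rho(A_C)$ for every component $C'\ne C$ with $C'E^*C\ne\emptyset$. $\pi_{\mathrm{mc}}(E)$ is the set of minimal components with $\rho(A_C)>1$; for such $C$, $\beta_C=\log\rho(A_C)$. A $\beta$-harmonic vector of $E$ is $\chi\in\mathbb R^{E^0}$ with nonnegative entries and $A_E\chi=e^\beta\chi$. The map $\varphi\mapsto[\varphi(p_v)]_{v\in E^0}$ is an isomorphism from the cone of KMS$_\beta$ positive functionals supported in $E^\infty$ onto the cone of $\beta$-harmonic vectors. For $C\in\pi_{\mathrm{mc}}(E)$, let $D$ be the set of vertices outside $C$ from which there is a path to $C$; $\psi_C$ is the (extremal) KMS$_{\beta_C}$ state supported in $E^\infty$ corresponding to $\tilde\chi/\|\tilde\chi\|_1$, where $\tilde\chi_C$ is a Perron–Frobenius eigenvector of $A_C$, $\tilde\chi_D=(e^{\beta_C}I-A_D)^{-1}A_{D,C}\tilde\chi_C$, and $\tilde\chi$ is $0$ elsewhere. Finally $\pi_{v,\mathrm{mc}}(E)=\{C\in\pi_{\mathrm{mc}}(E): CE^*v\ne\emptyset,\ \beta_C=\beta_v\}$. It is known that KMS$_{\beta_v}$ states arising as weak*-limits of $\varphi_{\beta,v}$ as $\beta\to\beta_v+0$ are convex combinations of the $\psi_C$, $C\in\pi_{v,\mathrm{mc}}(E)$. Graph of components. $B(E,C_0)$ is the finite graph with vertex set $\{C\in\pi(E): CE^*C_0\ne\emptyset\}$ and with exactly one edge from $C'$ to $C$, for distinct $C',C$, if there is $e\in E^1$ with $s(e)\in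 C'$ and $r(e)\in C$ (and no edge otherwise). A path $\mu$ in $B$ ending at $C_0$ (an element of $B^*C_0$, possibly of length $0$) passes through a set of components (including its starting one and $C_0$); $\mathrm{crit}(\mu)$ is the set of those components $C$ among them with $\rho(A_C)=e^{\beta_v}$. The path $\mu\in B^*C_0$ is a maximal path to $C_0$ if $|\mathrm{crit}(\mu)|=\max\{|\mathrm{crit}(\nu)|:\nu\in B^*C_0\}$. $CB^*C_0$ is the set of paths in $B$ from $C$ to $C_0$. *)

(* Defs.v *)
From HB Require Import structures.
From mathcomp Require Export all_boot all_order all_algebra.
From mathcomp Require Export complex.
From mathcomp Require Export all_classical all_reals all_analysis.
Set Implicit Arguments.
Unset Strict Implicit.
Unset Printing Implicit Defensive.
Export Order.TTheory GRing.Theory Num.Theory.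
Export numFieldNormedType.Exports.
#[export] Set Implicit Arguments.
#[export] Unset Strict Implicit.
#[export] Unset Printing Implicit Defensive.
Local Open Scope classical_set_scope.
Local Open Scope ring_scope.
Local Open Scope complex_scope.

(** * Finite directed graphs *)

Record digraph := Digraph {
  vert : finType;
  edge : finType;
  src : edge -> vert;
  rng : edge -> vert }.

(* A candidate path is a starting vertex with a list of edges, so that (x, [::])
   is the vertex x seen as a path of length 0. *)
Definition fpath (E : digraph) : Type := (vert E * seq (edge E))%type.

Fixpoint is_walk (E : digraph) (x : vert E) (q : seq (edge E)) : bool :=
  if q is e :: q' then (src e == x) && is_walk (rng e) q' else true.

Definition pstart (E : digraph) (mu : fpath E) : vert E := mu.1.
Definition pend (E : digraph) (mu : fpath E) : vert E :=
  last mu.1 (map (@rng E) mu.2).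
Definition plen (E : digraph) (mu : fpath E) : nat := size mu.2.
Definition pverts (E : digraph) (mu : fpath E) : seq (vert E) :=
  mu.1 :: map (@rng E) mu.2.

(* S E^* T; pred1 w and predT are used for {w} and for the whole vertex set. *)
Definition fpaths (E : digraph) (S T : {pred vert E}) : set (fpath E) :=
  [set mu : fpath E | [/\ is_walk mu.1 mu.2, pstart mu \in S & pend mu \in T]].

Definition reach (E : digraph) (S T : {pred vert E}) : bool :=
  `[< fpaths S T !=set0 >].

Definition components (E : digraph) : {set {set vert E}} :=
  equivalence_partition
    (fun x y : vert E => reach (pred1 x) (pred1 y) && reach (pred1 y) (pred1 x))
    [set: vert E]%SET.

Definition adj (R : realType) (E : digraph) (S T : {set vert E}) :
    'M[R]_(#|S|, #|T|) :=
  \matrix_(i, j)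
    (#|[set e : edge E | (src e == enum_val i) && (rng e == enum_val j)]%SET|)%:R.

Definition spectral_radius (R : realType) (n : nat) (M : 'M[R]_n) : R :=
  sup [set complex.Re `|z| | z in
        [set z : R[i] | eigenvalue (map_mx (real_complex R) M) z]].

Definition rho (R : realType) (E : digraph) (C : {set vert E}) : R :=
  spectral_radius (adj R C C).

(** * Partition functions and critical inverse temperatures *)

Definition Zsum (R : realType) (E : digraph) (S T : {pred vert E}) (beta : R) :
    \bar R :=
  \esum_(nu in fpaths S T) (expR (- beta * (plen nu)%:R))%:E.

Definition Zfun2 (R : realType) (E : digraph) (w v : vert E) (beta : R) :=
  Zsum (pred1 w) (pred1 v) beta.

Definition Zfun (R : realType) (E : digraph) (v : vert E) (beta : R) :=
  Zsum predT (pred1 v) beta.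

(* The infimum is -oo when only finitely many paths end at v. *)
Definition beta_crit (R : realType) (E : digraph) (v : vert E) : \bar R :=
  ereal_inf [set beta%:E | beta in [set beta : R | (Zfun v beta < +oo)%E]].

(** * C*-algebras (not necessarily unital) *)

(* As always over R[i], the norm is R[i]-valued, and 0 <= z in R[i] means that
   z is real and nonnegative. *)
Record cstarAlgebra (R : realType) := CStarAlgebra {
  cs_sort :> completeNormedModType R[i];
  cs_mul : cs_sort -> cs_sort -> cs_sort;
  cs_star : cs_sort -> cs_sort;
  cs_mulA : associative cs_mul;
  cs_mulDl : left_distributive cs_mul +%R;
  cs_mulDr : right_distributive cs_mul +%R;
  cs_mulZl : forall (k : R[i]) a b, cs_mul (k *: a) b = k *: cs_mul a b;
  cs_mulZr : forall (k : R[i]) a b, cs_mul a (k *: b) = k *: cs_mul a b;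
  cs_starK : involutive cs_star;
  cs_starD : {morph cs_star : a b / a + b};
  cs_starZ : forall (k : R[i]) a, cs_star (k *: a) = k^* *: cs_star a;
  cs_starM : forall a b, cs_star (cs_mul a b) = cs_mul (cs_star b) (cs_star a);
  cs_normM : forall a b, `|cs_mul a b| <= `|a| * `|b|;
  cs_normE : forall a, `|cs_mul (cs_star a) a| = `|a| ^+ 2 }.

Notation "a ** b" := (cs_mul a b) (at level 40, left associativity).
Notation "a ^#*" := (cs_star a) (at level 2, format "a ^#*").

Definition cs_le (R : realType) (A : cstarAlgebra R) (a b : A) : Prop :=
  exists c : A, b - a = c^#* ** c.

Definition star_hom (R : realType) (A B : cstarAlgebra R) (h : A -> B) : Prop :=
  [/\ linear h,
      forall a b, h (a ** b) = h a ** h b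
    & forall a, h a^#* = (h a)^#*].

Definition cstar_generated (R : realType) (A : cstarAlgebra R) (X : set A) :
    Prop :=
  forall S : set A,
    X `<=` S -> closed S -> S 0 ->
    (forall (k : R[i]) a b, S a -> S b -> S (k *: a + b)) ->
    (forall a b, S a -> S b -> S (a ** b)) ->
    (forall a, S a -> S a^#*) ->
    S = setT.

(** * The Toeplitz algebra of a graph *)

(* delta_v *)
Definition gap (R : realType) (E : digraph) (A : cstarAlgebra R)
    (p : vert E -> A) (s : edge E -> A) (v : vert E) : A :=
  p v - \sum_(e | src e == v) s e ** (s e)^#*.

Definition toeplitz_family (R : realType) (E : digraph) (A : cstarAlgebra R)
    (p : vert E -> A) (s : edge E -> A) : Prop :=
  [/\ forall v, (p v)^#* = p v /\ p v ** p v = p v,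
      forall v w, v != w -> p v ** p w = 0,
      forall e, (s e)^#* ** s e = p (rng e),
      forall e f, e != f -> (s e ** (s e)^#*) ** (s f ** (s f)^#*) = 0
    & forall v, cs_le (\sum_(e | src e == v) s e ** (s e)^#*) (p v)].

Definition is_toeplitz_algebra (R : realType) (E : digraph)
    (A : cstarAlgebra R) (p : vert E -> A) (s : edge E -> A) : Prop :=
  [/\ toeplitz_family p s,
      cstar_generated (range p `|` range s)
    & forall (B : cstarAlgebra R) (q : vert E -> B) (t : edge E -> B),
        toeplitz_family q t ->
        exists h : A -> B,
          [/\ star_hom h, forall v, h (p v) = q v & forall e, h (s e) = t e]].

Definition is_gauge_action (R : realType) (E : digraph) (A : cstarAlgebra R)
    (p : vert E -> A) (s : edge E -> A) (alpha : R -> A -> A) : Prop :=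
  [/\ (forall t, star_hom (alpha t)) /\ (forall a, alpha 0 a = a),
      forall t u a, alpha (t + u) a = alpha t (alpha u a),
      forall a, continuous (fun t : R => alpha t a),
      forall t v, alpha t (p v) = p v
    & forall t e, alpha t (s e) = (cos t +i* sin t) *: s e].

(** * KMS states *)

(* The algebra is not assumed unital, so "norm one" is phrased through the
   operator norm. *)
Definition is_state (R : realType) (A : cstarAlgebra R) (phi : A -> R[i]) :
    Prop :=
  [/\ scalar phi,
      forall a : A, 0 <= phi (a^#* ** a)
    & (forall a : A, `|phi a| <= `|a|) /\
      (forall eps : R, 0 < eps ->
        exists2 a : A, `|a| <= 1 & 1 - eps%:C < `|phi a|)].

(* f is the entire extension of t |-> alpha_t(a), so that
   f z = alpha_z(a) for complex z; it is unique when it exists. *)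
Definition entire_orbit (R : realType) (A : cstarAlgebra R)
    (alpha : R -> A -> A) (a : A) (f : R[i] -> A) : Prop :=
  (forall t : R, f t%:C = alpha t a) /\
  (forall z : R[i], derivable (f : R[i]^o -> A) z 1).

(* phi (a b) = phi (b alpha_{i beta}(a)) for every analytic element a. *)
Definition is_KMS_state (R : realType) (A : cstarAlgebra R)
    (alpha : R -> A -> A) (beta : R) (phi : A -> R[i]) : Prop :=
  is_state phi /\
  forall (a b : A) (f : R[i] -> A), entire_orbit alpha a f ->
    phi (a ** b) = phi (b ** f (0 +i* beta)).

Definition supported_in_Einf (R : realType) (E : digraph) (A : cstarAlgebra R)
    (p : vert E -> A) (s : edge E -> A) (phi : A -> R[i]) : Prop :=
  forall v, phi (gap p s v) = 0.

(* A KMS state is determined by its values on the p_w, so this determines phi;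
   both partition functions are finite for beta > beta_v. *)
Definition is_typeI_state (R : realType) (E : digraph) (A : cstarAlgebra R)
    (p : vert E -> A) (alpha : R -> A -> A) (v : vert E) (beta : R)
    (phi : A -> R[i]) : Prop :=
  is_KMS_state alpha beta phi /\
  forall w, phi (p w) = (fine (Zfun2 w v beta) / fine (Zfun v beta))%:C.

(* The weak*-limit as beta tends to beta0 from the right. *)
Definition weakstar_right_limit (R : realType) (A : cstarAlgebra R)
    (phi : R -> A -> R[i]) (beta0 : R) (phi0 : A -> R[i]) : Prop :=
  forall a : A,
    (fun beta : R => (phi beta a : R[i]^o)) @ beta0^'+ --> (phi0 a : R[i]^o).

(** * Minimal components and type III states *)

Definition minimal_component (R : realType) (E : digraph) (C : {set vert E}) :
    bool :=
  (C \in components E) &&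
  [forall C' in components E, (C' != C) ==> reach C' C ==> (rho R C' < rho R C)].

Definition pi_mc (R : realType) (E : digraph) : {set {set vert E}} :=
  [set C | minimal_component R C && (1 < rho R C)]%SET.

Definition beta_comp (R : realType) (E : digraph) (C : {set vert E}) : R :=
  ln (rho R C).

Definition pi_v_mc (R : realType) (E : digraph) (v : vert E) :
    {set {set vert E}} :=
  [set C in pi_mc R E |
    reach C (pred1 v) && ((beta_comp R C)%:E == beta_crit R v)]%SET.

Definition restr (R : realType) (E : digraph) (S : {set vert E})
    (chi : vert E -> R) : 'cV[R]_#|S| := \col_i chi (enum_val i).

Definition strict_ancestors (E : digraph) (C : {set vert E}) : {set vert E} :=
  [set w | (w \notin C) && reach (pred1 w) C]%SET.

(* chi restricted to C is a Perron-Frobenius eigenvector of A_C, determined up to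
   a positive factor.  For C minimal with rho(A_C) > 1 the spectral radius of A_D
   is less than e^{beta_C} = rho(A_C), so that invmx is a genuine inverse. *)
Definition is_chi (R : realType) (E : digraph) (C : {set vert E})
    (chi : vert E -> R) : Prop :=
  let D := strict_ancestors C in
  [/\ forall w, w \in C -> 0 < chi w,
      adj R C C *m restr C chi = rho R C *: restr C chi,
      restr D chi =
        invmx ((expR (beta_comp R C))%:M - adj R D D)
          *m adj R D C *m restr C chi
    & forall w, w \notin C -> w \notin D -> chi w = 0].

Definition is_psi (R : realType) (E : digraph) (A : cstarAlgebra R)
    (p : vert E -> A) (s : edge E -> A) (alpha : R -> A -> A)
    (C : {set vert E}) (psi : A -> R[i]) : Prop :=
  [/\ is_KMS_state alpha (beta_comp R C) psi,
      supported_in_Einf p s psi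
    & exists2 chi : vert E -> R, is_chi C chi &
        forall w, psi (p w) = (chi w / \sum_u `|chi u|)%:C].

Definition convex_decomposition (R : realType) (E : digraph)
    (A : cstarAlgebra R) (v : vert E) (psi : {set vert E} -> A -> R[i])
    (phi : A -> R[i]) (lam : {set vert E} -> R) : Prop :=
  [/\ forall C, C \in pi_v_mc R v -> 0 <= lam C,
      \sum_(C in pi_v_mc R v) lam C = 1
    & forall a, phi a = \sum_(C in pi_v_mc R v) (lam C)%:C * psi C a].

(** * The graph of components *)

Definition Bverts (E : digraph) (C0 : {set vert E}) : {set {set vert E}} :=
  [set C in components E | reach C C0]%SET.

Definition Bvert (E : digraph) (C0 : {set vert E}) : finType :=
  {C : {set vert E} | C \in Bverts C0}.

Definition Badj (E : digraph) (C' C : {set vert E}) : bool :=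
  (C' != C) && [exists e : edge E, (src e \in C') && (rng e \in C)].

Definition Bgraph (E : digraph) (C0 : {set vert E}) : digraph :=
  @Digraph (Bvert C0)
    {x : Bvert C0 * Bvert C0 | Badj (val x.1) (val x.2)}
    (fun x => (val x).1) (fun x => (val x).2).

(* C B^* C0, for B = B(E, C0) *)
Definition Bpaths (E : digraph) (C0 C : {set vert E}) : set (fpath (Bgraph C0)) :=
  fpaths [pred x : vert (Bgraph C0) | val x == C]
         [pred x : vert (Bgraph C0) | val x == C0].

(* B^* C0 *)
Definition Bpaths_to (E : digraph) (C0 : {set vert E}) :
    set (fpath (Bgraph C0)) :=
  fpaths predT [pred x : vert (Bgraph C0) | val x == C0].

Definition crit (R : realType) (E : digraph) (v : vert E) (C0 : {set vert E})
    (mu : fpath (Bgraph C0)) : {set vert (Bgraph C0)} :=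
  [set x in pverts mu | rho R (val x) == expR (fine (beta_crit R v))]%SET.

Definition maximal_path (R : realType) (E : digraph) (v : vert E)
    (C0 : {set vert E}) (mu : fpath (Bgraph C0)) : Prop :=
  Bpaths_to mu /\
  forall nu : fpath (Bgraph C0), Bpaths_to nu -> (#|crit R v nu| <= #|crit R v mu|)%N.

(* Main.v *)
Require Import Defs.
From mathcomp Require Import ring lra.
Local Open Scope classical_set_scope.
Local Open Scope ring_scope.
Local Open Scope complex_scope.

(** Write t = exp (- beta), t0 = exp (- beta_v), lam = exp beta_v, and let A be
the adjacency matrix.  Everything is decided by the vector z(t) of the partition
functions Z_{w,v}, which solves (1 - t A) z = e_v.

Existence of the limit.  By Cramer's rule every entry of z is a rational function
of t, so near t0 it is asymptotic to a positive constant times a power of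
t0 - t ([Zreal_order]).  Dividing by the sum of the entries, which is Z_v, the
entries of largest pole order survive and the others tend to 0.  The limit x is
an eigenvector of A for lam because Z_v blows up at t0: otherwise a finite
solution at t0 could be pushed slightly beyond t0 ([strict_supersolution],
[Zfun_fin_supersolution]), against the choice of beta_v as an infimum.

Which entries survive.  Reading the equation (1 - t A) z = e_v on one component C
and comparing leading terms, the pole order on C is the largest order among the
vertices outside C that C points to (or 0 if C contains v), plus one exactly when
rho(A_C) = lam ([component_order]).  The two cases are separated by
Perron-Frobenius facts: a positive vector y with A_C y = lam y forces
rho(A_C) = lam, and A_C y <= lam y with a strict inequality somewhere forces
rho(A_C) < lam; in the first case pairing with a positive left eigenvector shows
that the order rises by one and no more.  Unwinding the recursion, the pole order
of Z_{w,v} is the largest number of critical components met by a path of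
components from w to v, and x is positive on C iff some such path starting
at C is maximal ([maximal_path_order]).

Decomposition.  A nonnegative eigenvector of A for lam is a combination of the
vectors of the minimal critical components, the coefficient of C being the ratio
on C, where all other vectors vanish ([harmonic_decomposition]).  Hence the
coefficient at C is positive iff x is positive on C.

From vectors to states.  A KMS state is determined by its values on the p_w: the
words s_mu s_nu^* span a dense subspace and the KMS condition for the single
edges s_e, whose orbit extends to z |-> exp(iz) s_e, evaluates the state on them
([word_value]).  The relation p_{s(e)} s_e = s_e, which makes words multiply to
words, is proved up to elements killed by all KMS states ([src_defect_null]), which
takes the Cauchy-Schwarz inequality in place of the theory of positive elements.
States being contractive, convergence on a dense subspace gives weak*
convergence. *)

(** * Strict supersolutions of nonnegative kernels *)

Lemma finite_strict_ratio (R : realFieldType) (V : finType) (P : pred V)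
    (f g : V -> R) :
  (forall w, P w -> 0 < g w) -> (forall w, P w -> f w < g w) ->
  exists2 c : R, 0 <= c < 1 & forall w, P w -> f w <= c * g w.
Proof.
move=> g_gt0 fg; pose c := \big[Num.max/0]_(w | P w) (f w / g w).
have fc w : P w -> f w / g w <= c by move=> Pw; apply: le_bigmax_cond.
exists c; last by move=> w Pw; rewrite -ler_pdivrMr ?g_gt0// fc.
rewrite bigmax_ge_id/= /c; apply/bigmax_ltP; split=> // w Pw.
by rewrite ltr_pdivrMr ?g_gt0// mul1r fg.
Qed.

Section Kernel.
Variables (R : realType) (V : finType) (a : V -> V -> R).
Hypothesis a_ge0 : forall w u, 0 <= a w u.

Definition kernel_app (x : V -> R) (w : V) : R := \sum_u a w u * x u.

Lemma kernel_app_ge0 x : (forall w, 0 <= x w) -> forall w, 0 <= kernel_app x w.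
Proof. by move=> x0 w; apply: sumr_ge0 => u _; rewrite mulr_ge0. Qed.

Lemma kernel_app_le x y : (forall w, x w <= y w) ->
  forall w, kernel_app x w <= kernel_app y w.
Proof. by move=> xy w; apply: ler_sum => u _; rewrite ler_wpM2l. Qed.

Lemma kernel_appZ c x w : kernel_app (fun u => c * x u) w = c * kernel_app x w.
Proof. by rewrite /kernel_app mulr_sumr; apply: eq_bigr => u _; rewrite mulrCA. Qed.

Lemma kernel_appB x y w : kernel_app (fun u => x u - y u) w = kernel_app x w - kernel_app y w.
Proof. by rewrite /kernel_app -sumrB; apply: eq_bigr => u _; rewrite mulrBr. Qed.

Lemma kernel_app_sum n (x : nat -> V -> R) w :
  kernel_app (fun u => \sum_(i < n) x i u) w = \sum_(i < n) kernel_app (x i) w.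
Proof.
by rewrite /kernel_app exchange_big/=; apply: eq_bigr => u _; rewrite mulr_sumr.
Qed.

Lemma kernel_app_gt0 x w u : (forall w, 0 <= x w) -> 0 < a w u -> 0 < x u ->
  0 < kernel_app x w.
Proof.
move=> x0 awu xu; rewrite /kernel_app (bigD1 u)//= ltr_wpDr ?mulr_gt0//.
by apply: sumr_ge0 => i _; rewrite mulr_ge0.
Qed.

Lemma iter_kernel_app_ge0 n x : (forall w, 0 <= x w) -> forall w, 0 <= iter n kernel_app x w.
Proof. by move=> x0; elim: n => //= n IH; exact: kernel_app_ge0. Qed.

Lemma iter_kernel_app_gt0 x w p : (forall w, 0 <= x w) ->
  path (fun w u => 0 < a w u) w p -> 0 < x (last w p) ->
  0 < iter (size p) kernel_app x w.
Proof.
move=> x0; elim: p w => //= u p IH w /andP[awu pp] xl.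
by apply: kernel_app_gt0 awu _; [exact: iter_kernel_app_ge0|exact: IH].
Qed.

Definition kernel_connect : rel V := connect (fun w u => 0 < a w u).

(** If a x <= lam x and strictness can be reached along arrows from every point of
the support of x, then averaging x along the iterates of a / lam spreads the
strictness over the whole support, and by finiteness lam can be lowered.  This is
what gives strict inequalities between spectral radii, and what shows that the
partition function diverges at its critical temperature. *)
Lemma strict_supersolution (x : V -> R) (lam : R) : 0 < lam ->
  (forall w, 0 <= x w) -> (forall w, kernel_app x w <= lam * x w) ->
  (forall w, 0 < x w -> exists2 u, kernel_connect w u & kernel_app x u < lam * x u) ->
  exists (U : V -> R) (theta : R),
    [/\ 0 <= theta < lam, forall w, 0 <= U w, forall w, 0 < x w -> 0 < U w
      & forall w, kernel_app U w <= theta * U w].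
Proof.
move=> lam0 x0 xle xs.
pose T y w := lam^-1 * kernel_app y w.
have TE n y w : iter n T y w = lam ^- n * iter n kernel_app y w.
  elim: n w => [|n IH] w; first by rewrite expr0 invr1 mul1r.
  rewrite 2!iterS {1}/T (_ : iter n T y = fun u => lam ^- n * iter n kernel_app y u).
    by rewrite kernel_appZ mulrA -invfM -exprS.
  exact/funext.
have T0 n y : (forall w, 0 <= y w) -> forall w, 0 <= iter n T y w.
  by move=> y0 w; rewrite TE mulr_ge0 ?invr_ge0 ?exprn_ge0 ?iter_kernel_app_ge0 // ltW.
pose g w := x w - T x w.
have g0 w : 0 <= g w by rewrite subr_ge0 /T ler_pdivrMl.
(* With T = a / lam and g = x - T x, telescoping gives
   U - T U = \sum_(i < N) T^i g; N = #|V| + 1 terms are enough because a shortest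
   path has at most #|V| - 1 steps. *)
pose N := #|V|.+1.
pose U w := \sum_(i < N) iter i T x w.
have TU w : T U w = \sum_(i < N) iter i.+1 T x w.
  by rewrite /T kernel_app_sum mulr_sumr.
have TB n w : iter n T x w - iter n.+1 T x w = iter n T g w.
  elim: n w => //= n IH w; rewrite -/(iter n T g).
  rewrite -[iter n T g](_ : (fun w => iter n T x w - T (iter n T x) w) = _).
    by rewrite {1}/T -mulrBr -kernel_appB.
  by apply/funext => u; rewrite -IH.
have UTU w : U w - T U w = \sum_(i < N) iter i T g w.
  by rewrite TU -sumrB; apply: eq_bigr => i _; rewrite TB.
have gpos w : 0 < x w -> T U w < U w.
  move=> xw; rewrite -subr_gt0 UTU.
  have [u wu xu] := xs w xw.
  move: wu => /connectP[p0 /shortenP[p pp up _] lastp].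
  have sp : (size p < N)%N.
    by have := max_card (mem (w :: p)); rewrite (card_uniqP up) /= ltnS => /ltnW.
  rewrite (bigD1 (Ordinal sp))//= ltr_wpDr//; first by apply: sumr_ge0 => *; exact: T0.
  rewrite TE mulr_gt0 ?invr_gt0 ?exprn_gt0//; apply: iter_kernel_app_gt0 => //.
  by rewrite -lastp subr_gt0 /T ltr_pdivrMl.
have U0 w : 0 <= U w by apply: sumr_ge0 => *; exact: T0.
have Upos w : 0 < x w -> 0 < U w.
  by move=> /gpos; apply: le_lt_trans; rewrite /T mulr_ge0 ?invr_ge0 ?kernel_app_ge0// ltW.
have Tx0 n w : x w = 0 -> iter n T x w = 0.
  have dec m u : iter m T x u <= x u.
    elim: m u => //= m IH u; apply: (le_trans _ (_ : T x u <= _)).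
      by rewrite /T ler_pM2l ?invr_gt0//; apply: kernel_app_le.
    by rewrite /T ler_pdivrMl.
  by move=> xw; apply/le_anti; rewrite T0// andbT -xw dec.
have [c /andP[c0 c1] cU] := @finite_strict_ratio R V (fun w => 0 < x w)
   (T U) U Upos gpos.
exists U, (c * lam); split => //.
  by rewrite mulr_ge0 ?(ltW lam0)//= -[ltRHS]mul1r ltr_pM2r.
move=> w; rewrite (_ : kernel_app U w = lam * T U w); last first.
  by rewrite /T mulrA divff ?mul1r// gt_eqF.
rewrite [c * lam]mulrC -mulrA ler_pM2l//.
have [xw|xw] := ltP 0 (x w); first exact: cU.
have xw0 : x w = 0 by apply/le_anti; rewrite xw x0.
have -> : U w = 0 by apply: big1 => i _; exact: Tx0.
by rewrite TU mulr0 big1 // => i _; rewrite Tx0.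
Qed.

End Kernel.

(** * The spectral radius of a nonnegative matrix *)

Lemma normC_Re (R : realType) (z : R[i]) : `|z| = (complex.Re `|z|)%:C.
Proof. by rewrite RRe_real// ger0_real. Qed.

Section Spectral.
Variable R : realType.

(** If u M = z u, then |u| M >= |z| |u| entrywise; pairing with x gives
|z| (|u| x) <= |u| M x <= th (|u| x). *)
Lemma eigenvalue_norm_le n (M : 'M[R]_n) (x : 'I_n -> R) (th : R) (z : R[i]) :
  (forall i j, 0 <= M i j) -> (forall i, 0 < x i) ->
  (forall i, \sum_j M i j * x j <= th * x i) ->
  eigenvalue (map_mx (real_complex R) M) z -> complex.Re `|z| <= th.
Proof.
move=> M0 x0 Mx /eigenvalueP[u uM u0].
pose r i := complex.Re `|u 0 i|; pose c := complex.Re `|z|.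
have rE i : `|u 0 i| = (r i)%:C by exact: normC_Re.
have r0 i : 0 <= r i by rewrite -ler0c -rE.
have [k rk] : exists k, 0 < r k.
  apply/not_existsP => nr; move/eqP: u0; apply; apply/rowP => k; rewrite mxE.
  apply/eqP; rewrite -normr_eq0 rE; have := nr k; move/negP; rewrite -leNgt => rk.
  by rewrite (_ : r k = 0)//; apply/le_anti; rewrite rk r0.
have zr j : c * r j <= \sum_i r i * M i j.
  have uMj : \sum_i u 0 i * (M i j)%:C = z * u 0 j.
    have := congr1 (fun B : 'rV_n => B 0 j) uM; rewrite !mxE => <-.
    by apply: eq_bigr => i _; rewrite mxE.
  have : `|z * u 0 j| <= \sum_i `|u 0 i * (M i j)%:C|.
    by rewrite -uMj; exact: ler_norm_sum.
  rewrite normrM (normC_Re z) rE -rmorphM/=.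
  rewrite (_ : \sum_i _ = (\sum_i r i * M i j)%:C) ?lecR//.
  rewrite rmorph_sum/=; apply: eq_bigr => i _; rewrite normrM rmorphM/= rE.
  by rewrite [in X in _ * X]ger0_norm ?ler0c.
have S0 : 0 < \sum_j r j * x j.
  rewrite (bigD1 k)//= ltr_wpDr ?mulr_gt0//.
  by apply: sumr_ge0 => i _; rewrite mulr_ge0// ltW.
rewrite -(ler_pM2r S0) mulr_sumr.
apply: (@le_trans _ _ (\sum_j (\sum_i r i * M i j) * x j)).
  by apply: ler_sum => j _; rewrite mulrA ler_wpM2r// ltW.
under eq_bigr do rewrite mulr_suml.
rewrite exchange_big/= mulr_sumr; apply: ler_sum => i _.
rewrite mulrCA; under eq_bigr do rewrite -mulrA.
by rewrite -mulr_sumr ler_wpM2l.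
Qed.

Lemma spectral_radius_le n (M : 'M[R]_n) (x : 'I_n -> R) (th : R) : 0 <= th ->
  (forall i j, 0 <= M i j) -> (forall i, 0 < x i) ->
  (forall i, \sum_j M i j * x j <= th * x i) -> spectral_radius M <= th.
Proof.
move=> th0 M0 x0 Mx; rewrite /spectral_radius; set S := (X in sup X).
have [->|/set0P S0] := eqVneq S set0; first by rewrite sup0.
by apply: ge_sup => // _ [z ez <-]; exact: eigenvalue_norm_le ez.
Qed.

(** Eigenvalues are defined through row vectors; a matrix and its transpose have
the same characteristic polynomial. *)
Lemma eigenvalue_of_col n (M : 'M[R]_n) (x : 'cV[R]_n) (lam : R) :
  x != 0 -> M *m x = lam *: x -> eigenvalue M lam.
Proof.
move=> x0 Mx; rewrite eigenvalue_root_char.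
have -> : char_poly M = char_poly M^T.
  rewrite /char_poly -det_tr; congr (\det _); apply/matrixP => i j.
  by rewrite !mxE eq_sym.
rewrite -eigenvalue_root_char; apply/eigenvalueP; exists x^T.
  by rewrite -trmx_mul Mx linearZ.
by rewrite -(inj_eq (@trmx_inj _ _ _)) trmxK trmx0.
Qed.

Lemma spectral_radius_eig n (M : 'M[R]_n) (x : 'cV[R]_n) (lam : R) :
  0 <= lam -> (0 < n)%N ->
  (forall i j, 0 <= M i j) -> (forall i, 0 < x i 0) ->
  M *m x = lam *: x -> spectral_radius M = lam.
Proof.
move=> lam0 n0 M0 x0 Mx; have xM i : \sum_j M i j * x j 0 <= lam * x i 0.
  by have := congr1 (fun B : 'cV_n => B i 0) Mx; rewrite !mxE => ->.
apply/le_anti; rewrite (spectral_radius_le (x := fun i => x i 0))//=.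
apply: sup_ubound; last first.
  exists lam%:C; last by rewrite ger0_norm ?ler0c.
  rewrite /mkset eigenvalue_map; apply: eigenvalue_of_col Mx.
  apply/eqP => /(congr1 (fun B : 'cV_n => B (Ordinal n0) 0)); rewrite mxE.
  by move=> xz; have := x0 (Ordinal n0); rewrite xz ltxx.
by exists lam => _ [z ez <-]; exact: (eigenvalue_norm_le M0 x0 xM ez).
Qed.

End Spectral.

(** * Reachability and strongly connected components *)

Section Components.
Variable E : digraph.
Implicit Types (w u : vert E) (C : {set vert E}).

Definition arc : rel (vert E) :=
  fun w u => [exists e : edge E, (src e == w) && (rng e == u)].

Definition conn : rel (vert E) := connect arc.

Lemma conn_edge (e : edge E) : conn (src e) (rng e).
Proof. by apply: connect1; apply/existsP; exists e; rewrite !eqxx. Qed.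

Lemma conn_walk w (q : seq (edge E)) :
  is_walk w q -> conn w (pend (w, q)).
Proof.
rewrite /pend/=; elim: q w => [|e q IH] w /=; first by rewrite /conn connect0.
move=> /andP[/eqP <- /IH]; apply: connect_trans; exact: conn_edge.
Qed.

Lemma walk_conn w u : conn w u ->
  exists q : seq (edge E), is_walk w q /\ pend (w, q) = u.
Proof.
move=> /connectP[p]; elim: p w => [|x p IH] w /=.
  by move=> _ ->; exists [::].
move=> /andP[/existsP[e /andP[/eqP <- /eqP <-]] pp] up.
have [q [qw qu]] := IH _ pp up.
by exists (e :: q); rewrite /= eqxx.
Qed.

Lemma reachP (S T : {pred vert E}) :
  reflect (exists w u, [/\ w \in S, u \in T & conn w u]) (reach S T).
Proof.
apply: (iffP (asboolP _)) => [[[w q] [/= qw wS qT]]|[w [u [wS uT wu]]]].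
  by exists w, (pend (w, q)); split => //; exact: conn_walk.
by have [q [qw qu]] := walk_conn wu; exists (w, q); split; rewrite ?qu.
Qed.

Lemma reach1P w u : reach (pred1 w) (pred1 u) = conn w u.
Proof.
apply/reachP/idP => [[x [y [/eqP -> /eqP ->]]]//|wu].
by exists w, u; split => //; exact: eqxx.
Qed.

Definition comp_of w : {set vert E} := [set u | conn w u && conn u w]%SET.

Lemma componentsP C :
  reflect (exists w, C = comp_of w) (C \in components E).
Proof.
have eqc w : [set y in [set: vert E] | reach (pred1 w) (pred1 y) &&
    reach (pred1 y) (pred1 w)]%SET = comp_of w.
  by apply/setP => y; rewrite !inE !reach1P.
apply: (iffP imsetP) => [[w _ ->]|[w ->]]; exists w => //; exact: eqc.
Qed.

Lemma mem_comp_of w : w \in comp_of w.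
Proof. by rewrite inE /conn connect0. Qed.

Lemma comp_of_comp w : comp_of w \in components E.
Proof. by apply/componentsP; exists w. Qed.

Lemma comp_neq0 C : C \in components E -> exists w, w \in C.
Proof. by move=> /componentsP[w ->]; exists w; exact: mem_comp_of. Qed.

Lemma comp_conn C w u : C \in components E -> w \in C -> u \in C -> conn w u.
Proof.
move=> /componentsP[x ->]; rewrite !inE => /andP[_ wx] /andP[xu _].
exact: connect_trans xu.
Qed.

Lemma comp_closed C w u : C \in components E -> w \in C ->
  conn w u -> conn u w -> u \in C.
Proof.
move=> /componentsP[x ->]; rewrite !inE => /andP[xw wx] wu uw.
by rewrite /conn (connect_trans xw wu) (connect_trans uw wx).
Qed.

Lemma comp_ofE C w : C \in components E -> w \in C -> C = comp_of w.
Proof.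
move=> cC wC; apply/setP => u; rewrite [RHS]inE; apply/idP/andP => [uC|[wu uw]].
  by split; apply: comp_conn cC _ _.
exact: comp_closed cC wC _ _.
Qed.

Lemma comp_eq C C' w : C \in components E -> C' \in components E ->
  w \in C -> w \in C' -> C = C'.
Proof. by move=> cC cC' wC wC'; rewrite (comp_ofE cC wC) (comp_ofE cC' wC'). Qed.

Lemma reach_comp C (T : {pred vert E}) w : C \in components E -> w \in C ->
  reach C T -> exists2 u, u \in T & conn w u.
Proof.
move=> cC wC /reachP[x [u [xC uT xu]]]; exists u => //.
exact: connect_trans (comp_conn cC wC xC) xu.
Qed.

Lemma reach_compC C C' w u : C \in components E -> C' \in components E ->
  w \in C -> u \in C' -> reach C C' -> conn w u.
Proof.
move=> cC cC' wC uC' /(reach_comp cC wC)[x xC' wx].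
exact: connect_trans wx (comp_conn cC' xC' uC').
Qed.

Lemma comp_exit C w u : C \in components E -> w \in C -> u \notin C ->
  conn w u -> exists x y, [/\ x \in C, y \notin C, arc x y & conn y u].
Proof.
move=> cC wC uC /connectP[p]; elim: p w wC => [|y p IH] w wC /=.
  by move=> _ uw; rewrite uw wC in uC.
move=> /andP[wy pp] up; have [yC|yC] := boolP (y \in C); first exact: IH pp up.
by exists w, y; split => //; apply/connectP; exists p.
Qed.

(** A path joining two vertices of a component never leaves it, so a property
passed along the arrows inside C spreads over C. *)
Lemma comp_conn_ind C (P : pred (vert E)) w : C \in components E -> w \in C ->
  P w -> (forall x y, x \in C -> y \in C -> arc x y -> P x -> P y) ->
  forall u, u \in C -> P u.
Proof.
move=> cC wC Pw Pstep u uC.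
have /connectP[p] := comp_conn cC wC uC.
elim: p w wC Pw => [|y p IH] w wC Pw /=; first by move=> _ ->.
move=> /andP[wy pp] up.
have yC : y \in C.
  apply: (comp_closed cC wC (connect1 wy)).
  apply: (connect_trans (_ : conn y u) (comp_conn cC uC wC)).
  by apply/connectP; exists p.
exact: IH yC (Pstep _ _ wC yC wy Pw) pp up.
Qed.

End Components.

(** * The adjacency kernel and Perron-Frobenius theory on a component *)

Section AdjacencyKernel.
Variables (R : realType) (E : digraph).
Implicit Types (w u : vert E) (C : {set vert E}).

Definition edge_count w u : R := (#|[set e : edge E | (src e == w) && (rng e == u)]%SET|)%:R.

Lemma edge_count_ge0 w u : 0 <= edge_count w u. Proof. exact: ler0n. Qed.

Lemma edge_count_gt0 w u : (0 < edge_count w u) = arc w u.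
Proof.
rewrite ltr0n card_gt0; apply/set0Pn/existsP => -[e]; first by rewrite inE; exists e.
by move=> ee; exists e; rewrite inE.
Qed.

Lemma edge_count_eq0 w u : ~~ (0 < edge_count w u) -> edge_count w u = 0.
Proof. by move=> nwu; apply/le_anti; rewrite edge_count_ge0 leNgt nwu. Qed.

Lemma kernel_app_edges (x : vert E -> R) w :
  kernel_app edge_count x w = \sum_(e | src e == w) x (rng e).
Proof.
rewrite (partition_big (@rng E) xpredT)//=; apply: eq_bigr => u _.
rewrite (eq_bigr (fun=> x u)) => [|e /andP[_ /eqP->]//].
by rewrite sumr_const -mulr_natl /edge_count cardsE.
Qed.

Lemma kernel_app_split C (x : vert E -> R) w :
  kernel_app edge_count x w = \sum_(u in C) edge_count w u * x u +
    \sum_(u | u \notin C) edge_count w u * x u.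
Proof. by rewrite /kernel_app (bigID (mem C)). Qed.

(** The block A_C, extended by 0 to all vertices so that kernels of all components
live on one index type. *)
Definition comp_kernel C w u : R := if (w \in C) && (u \in C) then edge_count w u else 0.

Lemma kernel_app_comp C x w :
  kernel_app (comp_kernel C) x w = if w \in C then \sum_(u in C) edge_count w u * x u else 0.
Proof.
rewrite /kernel_app /comp_kernel; case: ifP => wC; last first.
  by rewrite big1// => u _; rewrite mul0r.
rewrite [RHS]big_mkcond/=; apply: eq_bigr => u _; case: ifP => //.
by rewrite mul0r.
Qed.

Lemma sum_adj_row C (y : vert E -> R) (i : 'I_#|C|) :
  \sum_j adj R C C i j * y (enum_val j) =
  \sum_(u in C) edge_count (enum_val i) u * y u.
Proof.
by rewrite [RHS]big_enum_val/=; apply: eq_bigr => j _; rewrite mxE.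
Qed.

(** The Perron-Frobenius statement that only the spectral radius has a positive
eigenvector. *)
Lemma rho_of_positive_eigenvector C (y : vert E -> R) lam : C \in components E -> 0 <= lam ->
  (forall w, w \in C -> 0 < y w) ->
  (forall w, w \in C -> \sum_(u in C) edge_count w u * y u = lam * y w) ->
  rho R C = lam.
Proof.
move=> cC lam0 y0 yC; apply: (spectral_radius_eig (x := restr C y)) => //.
- by have [w wC] := comp_neq0 cC; apply/card_gt0P; exists w.
- by move=> i j; rewrite mxE ler0n.
- by move=> i; rewrite mxE y0// enum_valP.
apply/colP => i; rewrite !mxE.
under eq_bigr do rewrite [restr C y _ _]mxE.
by rewrite sum_adj_row yC// enum_valP.
Qed.

Lemma rho_lt_of_strict_supersolution C (y : vert E -> R) lam : C \in components E -> 0 < lam ->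
  (forall w, w \in C -> 0 < y w) ->
  (forall w, w \in C -> \sum_(u in C) edge_count w u * y u <= lam * y w) ->
  (exists2 w, w \in C & \sum_(u in C) edge_count w u * y u < lam * y w) ->
  rho R C < lam.
Proof.
move=> cC lam0 y0 yC [w0 w0C yw0].
pose x w := if w \in C then y w else 0.
have kx w : kernel_app (comp_kernel C) x w =
    if w \in C then \sum_(u in C) edge_count w u * y u else 0.
  rewrite kernel_app_comp; case: ifP => // wC; apply: eq_bigr => u uC.
  by rewrite /x uC.
have [||||U [th [/andP[th0 thl] U0 Upos Ule]]] :=
  @strict_supersolution R _ (comp_kernel C) _ x lam lam0.
- by move=> w u; rewrite /comp_kernel; case: ifP => // _; exact: edge_count_ge0.
- by move=> w; rewrite /x; case: ifPn => // /y0/ltW.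
- by move=> w; rewrite kx /x; case: ifPn => [|_]; [exact: yC|rewrite mulr0].
- move=> w; rewrite /x; case: ifPn => [wC _|_]; last by rewrite ltxx.
  exists w0; last by rewrite kx w0C.
  apply: (comp_conn_ind (P := kernel_connect (comp_kernel C) w) cC wC) => //.
    exact: connect0.
  move=> a b aC bC ab wa; apply: connect_trans wa (connect1 _).
  by rewrite /comp_kernel aC bC edge_count_gt0.
apply: le_lt_trans thl.
apply: (spectral_radius_le (x := fun i => U (enum_val i))) => //.
- by move=> i j; rewrite mxE ler0n.
- by move=> i; apply: Upos; rewrite /x enum_valP y0// enum_valP.
- by move=> i; rewrite sum_adj_row; have := Ule (enum_val i); rewrite kernel_app_comp enum_valP.
Qed.

(** lam has some real left eigenvector l.  Then |l| A_C >= lam |l| entrywise, and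
the pairing of both sides with the positive right eigenvector y agrees, so |l| is
itself a left eigenvector; irreducibility makes it positive. *)
Lemma left_eigenvector C (y : vert E -> R) lam : C \in components E ->
  (forall w, w \in C -> 0 < y w) ->
  (forall w, w \in C -> \sum_(u in C) edge_count w u * y u = lam * y w) ->
  exists l : vert E -> R, (forall w, w \in C -> 0 < l w) /\
    (forall u, u \in C -> \sum_(w in C) l w * edge_count w u = lam * l u).
Proof.
move=> cC y0 yC; set M := adj R C C.
have M0 i j : 0 <= M i j by rewrite mxE ler0n.
have [w0 w0C] := comp_neq0 cC.
have lam0 : 0 <= lam.
  rewrite -(pmulr_lge0 _ (y0 _ w0C)) -yC//.
  by apply: sumr_ge0 => u uC; rewrite mulr_ge0 ?edge_count_ge0// ltW// y0.
have : eigenvalue M lam.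
  apply: (@eigenvalue_of_col _ _ _ (restr C y)).
    apply/eqP => /(congr1 (fun B : 'cV_#|C| => B (enum_rank_in w0C w0) 0)).
    rewrite !mxE enum_rankK_in// => yw; have := y0 _ w0C.
    by rewrite yw ltxx.
  apply/colP => i; rewrite !mxE.
  under eq_bigr do rewrite [restr C y _ _]mxE.
  by rewrite sum_adj_row yC// enum_valP.
move=> /eigenvalueP[l lM l0].
pose r i := `|l 0 i|.
have r0 i : 0 <= r i by exact: normr_ge0.
have rle j : lam * r j <= \sum_i r i * M i j.
  have := congr1 (fun B : 'rV_#|C| => B 0 j) lM; rewrite !mxE => lj.
  rewrite /r -[lam]ger0_norm// -normrM -lj.
  apply: le_trans (ler_norm_sum _ _ _) _.
  by apply: ler_sum => i _; rewrite normrM (ger0_norm (M0 _ _)).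
have My i : \sum_j M i j * y (enum_val j) = lam * y (enum_val i).
  by rewrite sum_adj_row yC// enum_valP.
have S0 : \sum_j (\sum_i r i * M i j - lam * r j) * y (enum_val j) = 0.
  under eq_bigr do rewrite mulrBl mulr_suml.
  rewrite sumrB exchange_big/=.
  apply/eqP; rewrite subr_eq0; apply/eqP; apply: eq_bigr => i _.
  under eq_bigr do rewrite -mulrA.
  by rewrite -mulr_sumr My mulrA [r i * lam]mulrC.
have rE j : \sum_i r i * M i j = lam * r j.
  have := @psumr_eq0P _ _ xpredT _ _ S0 j isT.
  move=> /(_ _)/eqP; rewrite mulf_eq0 (gt_eqF (y0 _ (enum_valP j))) orbF.
  rewrite subr_eq0 => /(_ _)/eqP; apply => i _.
  by rewrite mulr_ge0 ?subr_ge0// ltW// y0// enum_valP.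
(* the row vector r read as a function on vertices, 0 outside C *)
pose L w := \sum_(i | enum_val i == w) r i.
have Lr (i : 'I_#|C|) : L (enum_val i) = r i.
  by rewrite /L (big_pred1 i)// => j /=; rewrite (inj_eq enum_val_inj).
have L0 w : 0 <= L w by exact: sumr_ge0.
have LE u : u \in C -> \sum_(w in C) L w * edge_count w u = lam * L u.
  move=> uC; rewrite -(enum_rankK_in uC uC) Lr -rE [LHS]big_enum_val/=.
  by apply: eq_bigr => i _; rewrite Lr mxE.
have [k rk] : exists k, 0 < r k.
  apply/not_existsP => nr; move/eqP: l0; apply; apply/rowP => k; rewrite mxE.
  by apply/eqP; rewrite -normr_le0 leNgt; apply/negP; exact: nr.
exists L; split => // w wC.
apply: (comp_conn_ind (P := fun w => 0 < L w) cC (enum_valP k)) => //.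
  by rewrite Lr.
move=> a b aC bC ab La.
have : 0 < lam * L b.
  rewrite -LE// (bigD1 a)//= ltr_wpDr ?mulr_gt0 ?edge_count_gt0//.
  by apply: sumr_ge0 => i _; rewrite mulr_ge0 ?edge_count_ge0.
move=> h; rewrite lt_neqAle L0 andbT; apply: contraTneq h => <-.
by rewrite mulr0 ltxx.
Qed.

End AdjacencyKernel.

(** * Partition functions as sums over walks *)

Lemma esumZl (R : realType) (T : choiceType) (S : set T) (a : T -> \bar R)
    (r : R) : 0 < r -> (forall x, S x -> (0 <= a x)%E) ->
  (\esum_(i in S) (r%:E * a i) = r%:E * \esum_(i in S) a i)%E.
Proof.
move=> r0 a0; rewrite /esum -ereal_sup_pZl//; congr ereal_sup.
have E A : fsets S A ->
    (\sum_(x \in A) (r%:E * a x) = r%:E * \sum_(x \in A) a x)%E.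
  move=> [finA AS]; rewrite !fsbig_finite//= big_seq_cond [in RHS]big_seq_cond.
  rewrite ge0_sume_distrr// => x; rewrite andbT in_fset_set// inE => /AS.
  exact: a0.
apply/seteqP; split => [_ [A SA <-]|_ [_ [A SA <-] <-]].
  by exists (\sum_(x \in A) a x)%E; [exists A|rewrite E].
by exists A => //; rewrite E.
Qed.

Section WalkSums.
Variables (R : realType) (E : digraph) (v : vert E) (t : R).
Hypothesis t_gt0 : 0 < t.

(** The condition K on the length serves both for the full partition function and
for its truncations, which satisfy the same recursion. *)
Definition walks_to (K : pred nat) (w : vert E) : set (seq (edge E)) :=
  [set q | [/\ is_walk w q, pend (w, q) = v & K (size q)]].

Definition walk_sum (K : pred nat) (w : vert E) : \bar R :=
  \esum_(q in walks_to K w) (t ^+ size q)%:E.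

Let wt_ge0 n : (0 <= (t ^+ n)%:E)%E.
Proof. by rewrite lee_fin exprn_ge0// ltW. Qed.

Lemma walk_sum_ge0 K w : (0 <= walk_sum K w)%E.
Proof. exact: esum_ge0. Qed.

(** Split a walk according to its first edge. *)
Lemma walk_sum_rec K w :
  (walk_sum K w = (((w == v) && K 0)%N%:R)%:E +
    \sum_(e | src e == w) t%:E * walk_sum (fun n => K n.+1) (rng e))%E.
Proof.
rewrite {1}/walk_sum (esumID [set ([::] : seq (edge E))])//; congr (_ + _)%E.
  have [wv|nwv] := boolP ((w == v) && K 0%N).
    rewrite (_ : _ `&` _ = [set [::]]) ?esum_set1//=.
    move: wv => /andP[/eqP wv K0].
    by apply/seteqP; split => [q [_ ->]//|q ->]; split => //; split.
  rewrite (_ : _ `&` _ = set0) ?esum_set0//.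
  apply/seteqP; split => // q [[_ qv Kq] q0]; move: qv Kq nwv; rewrite q0 /pend/=.
  by move=> -> ->; rewrite eqxx.
transitivity (\esum_(q in walks_to K w `&` ~` [set [::]])
    \sum_(e | src e == w)
      (if q \in [set q | ohead q = Some e] then (t ^+ size q)%:E else 0))%E.
  apply: eq_esum => -[|e q] [[/= ew _ _] /= q0]; first by case: q0.
  rewrite (bigD1 e)/=; last by case/andP: ew.
  rewrite ifT ?in_setE//= big1 ?adde0// => f /andP[_ fe].
  by rewrite ifF//; apply/negP => /set_mem/= [ef]; rewrite ef eqxx in fe.
rewrite esum_sum; last by move=> q e _ _; case: ifP.
apply: eq_bigr => e /eqP we; rewrite -esum_mkcondr.
rewrite (_ : _ `&` _ = cons e @` walks_to (fun n => K n.+1) (rng e)).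
  rewrite esum_image; last by move=> q q' _ _ [].
  by rewrite -esumZl//; apply: eq_esum => q _; rewrite -EFinM exprS.
apply/seteqP; split => [[|f q]|_ [q [qw qv Kq] <-]].
- by move=> [[_ ]].
- move=> [[[/= /andP[_ qw] qv Kq] _] /= [<-]]; exists q => //; split => //.
- by split => //; split => //; split => //=; rewrite we eqxx.
Qed.

(** z is the least nonnegative solution of z = e_v + t A z: by induction on N the
sum over walks of length less than N stays below every supersolution, and every
finite set of walks has bounded length. *)
Lemma walk_sum_le_supersolution (U : vert E -> R) : (forall w, 0 <= U w) ->
  (forall w, (w == v)%:R + t * kernel_app (@edge_count R E) U w <= U w) ->
  forall w, (walk_sum predT w <= (U w)%:E)%E.
Proof.
move=> U0 Ule.
have trunc N w : (walk_sum (fun n => n < N)%N w <= (U w)%:E)%E.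
  elim: N w => [|N IH] w.
    rewrite /walk_sum (_ : walks_to _ _ = set0) ?esum_set0 ?lee_fin//.
    by apply/seteqP; split => // q [].
  rewrite walk_sum_rec andbT.
  apply: (@le_trans _ _ ((w == v)%:R%:E + \sum_(e | src e == w) (t * U (rng e))%:E)%E).
    apply: leeD => //; apply: lee_sum => e _; rewrite EFinM.
    by apply: lee_pmul; rewrite ?lee_fin ?walk_sum_ge0 ?(ltW t_gt0)// IH.
  by rewrite sumEFin -EFinD lee_fin -mulr_sumr -kernel_app_edges.
move=> w; apply: ge_ereal_sup => _ [X [finX XW] <-].
have [r Xr] := (finite_seqP _).1 finX.
pose N := (\max_(q <- r) size q).+1.
apply: le_trans (trunc N w); rewrite -esum_fset//.
rewrite esum_mkcond [leRHS]esum_mkcond; apply: le_esum => q _.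
case: ifPn => qX; last by case: ifP.
rewrite ifT//; move: qX; rewrite !in_setE => qX.
have [qw qv _] := XW _ qX; split => //.
rewrite ltnS; apply: (leq_bigmax_seq (F := size)) => //.
by rewrite Xr in qX.
Qed.

End WalkSums.

Section PartitionFunctions.
Variables (R : realType) (E : digraph) (v : vert E).
Implicit Types (beta : R) (w : vert E).

Let wt beta (nu : fpath E) := (expR (- beta * (plen nu)%:R))%:E.

Let wt_ge0 beta nu : (0 <= wt beta nu)%E.
Proof. by rewrite lee_fin expR_ge0. Qed.

Lemma Zfun2_walk_sum w beta : Zfun2 w v beta = walk_sum v (expR (- beta)) predT w.
Proof.
rewrite /Zfun2 /Zsum (reindex_esum (walks_to v predT w) _ (fun q => (w, q)))//.
  by apply: eq_esum => q _; rewrite expRM_natr.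
split => [q [qw qv _]|q q' _ _ []//|[x q] [/= qx /eqP xw qv]].
  by split => //; apply/eqP.
by exists q; [split => //; [rewrite -xw|rewrite -xw; apply/eqP]|rewrite -xw].
Qed.

Lemma Zfun_sum beta : Zfun v beta = (\sum_w Zfun2 w v beta)%E.
Proof.
rewrite /Zfun /Zfun2 /Zsum.
transitivity (\esum_(nu in fpaths predT (pred1 v))
   \sum_w (if nu \in [set nu : fpath E | pstart nu = w] then wt beta nu else 0))%E.
  apply: eq_esum => nu _; rewrite (bigD1 (pstart nu))//= ifT ?in_setE//.
  rewrite big1 ?adde0// => w wnu; rewrite ifF//; apply/negP => /set_mem/= nuw.
  by rewrite nuw eqxx in wnu.
rewrite esum_sum; last by move=> nu w _ _; case: ifP.
apply: eq_bigr => w _; rewrite -esum_mkcondr; congr (esum _ _).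
apply/seteqP; split => [nu [[? _ ?] ?]|nu [? /eqP ? ?]] //.
  by split => //; apply/eqP.
Qed.

Lemma Zfun2_ge0 w beta : (0 <= Zfun2 w v beta)%E.
Proof. exact: esum_ge0. Qed.

Lemma Zfun2_disconnected w beta : ~~ conn w v -> Zfun2 w v beta = 0%E.
Proof.
move=> wv; rewrite Zfun2_walk_sum /walk_sum (_ : walks_to _ _ _ = set0) ?esum_set0//.
apply/seteqP; split => // q [qw qv _]; move/negP: wv; apply.
by rewrite -qv; exact: conn_walk.
Qed.

Lemma Zfun_anti beta beta' : beta <= beta' -> (Zfun v beta' <= Zfun v beta)%E.
Proof.
move=> bb; apply: le_esum => nu _; rewrite lee_fin ler_expR ler_wpM2r ?ler0n//.
by rewrite lerN2.
Qed.

(** If A U <= theta U with theta < exp beta, then a multiple c U satisfies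
e_v + t A (c U) <= c U; the constant c is what the inequality at v requires. *)
Lemma Zfun_fin_supersolution (U : vert E -> R) (theta beta : R) :
  0 <= theta -> theta < expR beta -> (forall w, 0 <= U w) -> 0 < U v ->
  (forall w, kernel_app (@edge_count R E) U w <= theta * U w) -> (Zfun v beta < +oo)%E.
Proof.
move=> th0 thb U0 Uv Ule; pose t := expR (- beta).
have t0 : 0 < t := expR_gt0 _.
have tth : 0 < 1 - t * theta.
  by rewrite subr_gt0 /t expRN mulrC ltr_pdivrMr ?expR_gt0// mul1r.
pose c := ((1 - t * theta) * U v)^-1.
have c0 : 0 < c by rewrite invr_gt0 mulr_gt0.
have le w : (Zfun2 w v beta <= (c * U w)%:E)%E.
  rewrite Zfun2_walk_sum.
  apply: (@walk_sum_le_supersolution _ _ _ _ t0 (fun w => c * U w)).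
    by move=> x; rewrite mulr_ge0// ltW.
  move=> x; rewrite kernel_appZ -lerBrDr.
  apply: (@le_trans _ _ (c * (1 - t * theta) * U x)).
    have [->|_] := eqVneq x v.
      by rewrite -mulrA /c mulVf// gt_eqF// mulr_gt0.
    by rewrite !mulr_ge0// ltW.
  rewrite -mulrA mulrBl mul1r mulrBr lerD2l lerN2 mulrCA ler_pM2l//.
  by rewrite -mulrA ler_pM2l.
rewrite Zfun_sum; apply: (@le_lt_trans _ _ (\sum_w (c * U w)%:E)%E).
  by apply: lee_sum => w _; exact: le.
by rewrite sumEFin ltry.
Qed.

(** The constant vector satisfies A 1 <= theta 1, with theta the number of
edges. *)
Lemma Zfun_fin_large : exists beta, (Zfun v beta < +oo)%E.
Proof.
pose th := \sum_w kernel_app (@edge_count R E) (fun=> 1) w.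
have k0 w : 0 <= kernel_app (@edge_count R E) (fun=> 1) w.
  by apply: kernel_app_ge0 => // ? ?; exact: edge_count_ge0.
have th0 : 0 <= th by apply: sumr_ge0.
exists th; apply: (@Zfun_fin_supersolution (fun=> 1) th) => //.
  by apply: lt_le_trans (expR_ge1Dx _); rewrite ltrDr.
move=> w; rewrite mulr1 /th (bigD1 w)//= lerDl; exact: sumr_ge0.
Qed.

Section Finite.
Variable beta : R.
Hypothesis Zfin : (Zfun v beta < +oo)%E.

(** Meaningful only where the partition function is finite; [fine] sends +oo
to 0. *)
Definition Zreal beta w : R := fine (Zfun2 w v beta).

Lemma Zfun2_fin w : Zfun2 w v beta \is a fin_num.
Proof.
rewrite ge0_fin_numE ?Zfun2_ge0//; apply: le_lt_trans Zfin.
rewrite Zfun_sum (bigD1 w)//= leeDl//; apply: sume_ge0 => u _; exact: Zfun2_ge0.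
Qed.

Lemma ZrealE w : (Zreal beta w)%:E = Zfun2 w v beta.
Proof. by rewrite fineK// Zfun2_fin. Qed.

Lemma Zreal_ge0 w : 0 <= Zreal beta w.
Proof. by rewrite -lee_fin ZrealE Zfun2_ge0. Qed.

Lemma fine_Zfun : fine (Zfun v beta) = \sum_w Zreal beta w.
Proof.
rewrite Zfun_sum (eq_bigr (fun w => (Zreal beta w)%:E)) ?sumEFin// => w _.
by rewrite ZrealE.
Qed.

Lemma Zreal_rec w :
  Zreal beta w = (w == v)%:R + expR (- beta) * kernel_app (@edge_count R E) (Zreal beta) w.
Proof.
apply: EFin_inj; rewrite ZrealE Zfun2_walk_sum walk_sum_rec ?expR_gt0// andbT.
rewrite EFinD kernel_app_edges mulr_sumr -sumEFin; congr (_ + _)%E.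
by apply: eq_bigr => e _; rewrite EFinM ZrealE Zfun2_walk_sum.
Qed.

Lemma Zreal_disconnected w : ~~ conn w v -> Zreal beta w = 0.
Proof. by move=> wv; rewrite /Zreal Zfun2_disconnected. Qed.

Lemma Zreal_arc w u : expR (- beta) * (edge_count R w u * Zreal beta u) <= Zreal beta w.
Proof.
rewrite [leRHS]Zreal_rec ler_wpDl ?ler0n// ler_pM2l ?expR_gt0//.
rewrite /kernel_app (bigD1 u)//= lerDl; apply: sumr_ge0 => i _.
by rewrite mulr_ge0 ?edge_count_ge0// Zreal_ge0.
Qed.

Lemma Zreal_v_ge1 : 1 <= Zreal beta v.
Proof.
rewrite Zreal_rec eqxx lerDl mulr_ge0 ?expR_ge0//; apply: kernel_app_ge0 => *.
  exact: edge_count_ge0.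
exact: Zreal_ge0.
Qed.

Lemma Zreal_gt0 w : conn w v -> 0 < Zreal beta w.
Proof.
move=> /connectP[p]; elim: p w => [|u p IH] w /=.
  by move=> _ <-; apply: lt_le_trans Zreal_v_ge1.
move=> /andP[wu pp] lp; apply: lt_le_trans (Zreal_arc w u).
by rewrite !mulr_gt0 ?expR_gt0 ?edge_count_gt0// IH.
Qed.

End Finite.

End PartitionFunctions.

(** * One-sided limits and pole orders *)

Lemma cvg_bigsum (R : realType) (T : Type) (F : set_system T) (FF : Filter F)
    (I : finType) (P : pred I) (f : I -> T -> R) (a : I -> R) :
  (forall i, P i -> f i x @[x --> F] --> a i) ->
  \sum_(i | P i) f i x @[x --> F] --> \sum_(i | P i) a i.
Proof.
move=> fa; have K (s : seq I) :
    \sum_(i <- s | P i) f i x @[x --> F] --> \sum_(i <- s | P i) a i.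
  elim: s => [|i s IH].
    by rewrite big_nil; under eq_fun do rewrite big_nil; exact: cvg_cst.
  rewrite big_cons; under eq_fun do rewrite big_cons.
  by case: ifPn => // /fa fi; exact: cvgD.
exact: K.
Qed.

Section RightLimits.
Variables (R : realType) (b : R).

Lemma right_cvg_unique (f : R -> R) (x y : R) :
  f z @[z --> b^'+] --> x -> f z @[z --> b^'+] --> y -> x = y.
Proof.
move=> fx fy.
exact: (cvg_unique (F := f z @[z --> b^'+]) (@norm_hausdorff _ R^o) fx fy).
Qed.

Lemma right_cvg_ext (f g : R -> R) (x : R) :
  (forall z, b < z -> f z = g z) ->
  f z @[z --> b^'+] --> x -> g z @[z --> b^'+] --> x.
Proof.
move=> fg; apply: cvg_trans; apply: near_eq_cvg.
by near=> z; rewrite fg//; near: z; exact: nbhs_right_gt.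
Unshelve. all: end_near. Qed.

Lemma right_cvg_ge0 (f : R -> R) (x : R) :
  (forall z, b < z -> 0 <= f z) -> f z @[z --> b^'+] --> x -> 0 <= x.
Proof.
move=> f0 fx; rewrite -(cvg_lim (@norm_hausdorff _ R^o) fx).
apply: limr_ge; first by apply/cvg_ex; exists x.
by near=> z; apply: f0; near: z; exact: nbhs_right_gt.
Unshelve. all: end_near. Qed.

Lemma right_cvg_le (f g : R -> R) (x y : R) :
  (forall z, b < z -> f z <= g z) -> f z @[z --> b^'+] --> x ->
  g z @[z --> b^'+] --> y -> x <= y.
Proof.
move=> fg fx gy; rewrite -subr_ge0.
apply: (@right_cvg_ge0 (fun z => g z - f z)); last exact: cvgB.
by move=> z bz; rewrite subr_ge0 fg.
Qed.

Lemma expRN_cvg : expR (- z) @[z --> b^'+] --> expR (- b).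
Proof.
apply: cvg_at_right_filter.
apply: (@continuous_comp _ _ _ (fun z : R => - z) expR b).
  by move=> U; apply: cvgN; exact: cvg_id.
exact: continuous_expR.
Qed.

(** This is t0 - t for t = exp (- z) and t0 = exp (- b). *)
Definition weight_gap z : R := expR (- b) - expR (- z).

Lemma weight_gap_gt0 z : b < z -> 0 < weight_gap z.
Proof. by move=> bz; rewrite subr_gt0 ltr_expR ltrN2. Qed.

Lemma weight_gap_cvg0 : weight_gap z @[z --> b^'+] --> 0.
Proof.
rewrite -[X in _ --> X](subrr (expR (- b))).
by apply: cvgB; [exact: cvg_cst|exact: expRN_cvg].
Qed.

Lemma horner_expRN_cvg (p : {poly R}) :
  p.[expR (- z)] @[z --> b^'+] --> p.[expR (- b)].
Proof.
apply: (@cvg_comp _ _ _ (fun z : R => expR (- z)) (horner p)).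
  exact: expRN_cvg.
exact: continuous_horner.
Qed.

Variable k : nat.

(** With tau = t0 - t, the function tau ^ k / tau ^ m * f has a positive limit iff
f has a pole of order k - m.  Here k is the multiplicity of t0 as a root of the
common denominator, so that all orders are expressed by natural numbers m, and a
larger pole means a smaller m. *)
Definition scaled (m : nat) (f : R -> R) (z : R) : R :=
  weight_gap z ^+ k / weight_gap z ^+ m * f z.

(** Multiplying by a positive power of t0 - t sends a finite limit to 0. *)
Lemma scaled_cvg_lower m m' (f : R -> R) (y : R) : (m' <= m)%N ->
  scaled m f z @[z --> b^'+] --> y ->
  scaled m' f z @[z --> b^'+] --> (m == m')%:R * y.
Proof.
rewrite leq_eqVlt eq_sym => /orP[/eqP ->|mm'] fy; first by rewrite eqxx mul1r.
rewrite gtn_eqF// mul0r.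
apply: (@right_cvg_ext (fun z => weight_gap z * weight_gap z ^+ (m - m').-1 * scaled m f z)).
  move=> z bz; have g0 := weight_gap_gt0 bz; have gn : weight_gap z != 0 by rewrite gt_eqF.
  rewrite -exprS prednK ?subn_gt0// /scaled mulrA; congr (_ * _).
  rewrite mulrCA; congr (_ * _).
  by rewrite expfB// ?mulfVK// ?expf_neq0// mulrAC divff ?expf_neq0// mul1r.
rewrite -(mul0r y); apply: cvgM => //.
rewrite -(mul0r (0 ^+ (m - m').-1)); apply: cvgM; first exact: weight_gap_cvg0.
have [->|n0] := posnP (m - m').-1; first by under eq_fun do rewrite expr0; rewrite expr0; exact: cvg_cst.
elim: (m - m').-1 => [|n IH].
  by under eq_fun do rewrite expr0; rewrite expr0; exact: cvg_cst.
by under eq_fun do rewrite exprS; rewrite exprS; apply: cvgM => //; exact: weight_gap_cvg0.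
Qed.

Lemma scaled_ge0 m f z : b < z -> 0 <= f z -> 0 <= scaled m f z.
Proof. by move=> bz f0; rewrite mulr_ge0// divr_ge0// exprn_ge0// ltW// weight_gap_gt0. Qed.

Lemma scaled_le m f g z : b < z -> f z <= g z -> scaled m f z <= scaled m g z.
Proof. by move=> bz fg; rewrite ler_wpM2l// divr_ge0// exprn_ge0// ltW// weight_gap_gt0. Qed.

Lemma scaledS m f z : b < z -> weight_gap z * scaled m.+1 f z = scaled m f z.
Proof.
move=> bz; have gn : weight_gap z != 0 by rewrite gt_eqF// weight_gap_gt0.
by rewrite /scaled exprS; field; rewrite gn expf_neq0.
Qed.

End RightLimits.

(** * Rationality of the partition functions *)

Section Rationality.
Variables (R : realType) (E : digraph) (v : vert E).
Notation n := #|vert E|.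

(** 1 - X A over the polynomial ring, where X stands for t. *)
Definition resolvent_mx : 'M[{poly R}]_n :=
  1%:M - \matrix_(i, j) ('X * (edge_count R (enum_val i) (enum_val j))%:P).

(** Multiply (1 - t A) z = e_v by the adjugate of 1 - t A; the determinant is not
the zero polynomial since its value at t = 0 is 1. *)
Lemma Zreal_rational : exists (q : {poly R}) (P : vert E -> {poly R}), q != 0 /\
  forall beta, (Zfun v beta < +oo)%E -> forall w,
    q.[expR (- beta)] * Zreal v beta w = (P w).[expR (- beta)].
Proof.
exists (\det resolvent_mx), (fun w => \adj resolvent_mx (enum_rank w) (enum_rank v)).
have ev (t : R) : map_mx (horner_eval t) resolvent_mx =
    1%:M - t *: \matrix_(i, j) edge_count R (enum_val i) (enum_val j).
  apply/matrixP => i j; rewrite !mxE /horner_eval hornerD hornerN.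
  rewrite hornerM hornerX hornerC; congr (_ - _).
  by case: (i == j); rewrite ?hornerC ?horner0.
split.
  apply/eqP => /(congr1 (horner_eval 0)); rewrite -det_map_mx ev.
  by rewrite scale0r subr0 det1 rmorph0 => /eqP; rewrite oner_eq0.
move=> beta Zfin w; set t := expR (- beta).
pose z : 'cV[R]_n := \col_i Zreal v beta (enum_val i).
pose e : 'cV[R]_n := \col_i (enum_val i == v)%:R.
have Mz : map_mx (horner_eval t) resolvent_mx *m z = e.
  rewrite ev mulmxBl mul1mx -scalemxAl; apply/colP => i; rewrite !mxE.
  rewrite (Zreal_rec Zfin) -/t; apply/eqP; rewrite subr_eq; apply/eqP.
  congr (_ + t * _); rewrite /kernel_app (reindex (@enum_val _ predT))/=.
    by apply: eq_bigr => j _; rewrite !mxE.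
  by apply: onW_bij; exact: enum_val_bij.
have := congr1 (fun B => (\adj (map_mx (horner_eval t) resolvent_mx) *m B) (enum_rank w) 0) Mz.
rewrite mulmxA mul_adj_mx mul_scalar_mx det_map_mx -map_mx_adj !mxE enum_rankK => ->.
rewrite (bigD1 (enum_rank v))//= !mxE enum_rankK eqxx mulr1 big1 ?addr0//.
move=> i iv; rewrite !mxE (_ : enum_val i == v = false) ?mulr0//.
by apply: contraNF iv => /eqP <-; rewrite enum_valK.
Qed.

Variable b : R.
Hypothesis Zfin : forall beta, b < beta -> (Zfun v beta < +oo)%E.

(** Strip from numerator and denominator the powers of X - t0; the remaining
quotient has a nonzero limit, which is positive because Z_{w,v} is. *)
Lemma Zreal_order : exists k : nat, forall w, conn w v ->
  exists (m : nat) (y : R), 0 < y /\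
    scaled b k m (Zreal v ^~ w) z @[z --> b^'+] --> y.
Proof.
have [q [P [q0 qP]]] := Zreal_rational.
set t0 := expR (- b).
have [k [Q Q0 qE]] := multiplicity_XsubC q t0.
rewrite q0/= in Q0; exists k => w wv.
have [m [Pw Pw0 PE]] := multiplicity_XsubC (P w) t0.
pose sg : R := (-1) ^+ k * (-1) ^+ m.
have key z : b < z -> Pw.[expR (- z)] * sg =
    Q.[expR (- z)] * scaled b k m (Zreal v ^~ w) z.
  move=> bz; have gz := weight_gap_gt0 bz.
  have := qP z (Zfin bz) w; rewrite {1}qE PE !hornerM !horner_exp !hornerXsubC.
  rewrite -[expR (- z) - t0]opprB -/(weight_gap b z) exprNn [in RHS]exprNn.
  have gm : weight_gap b z ^+ m != 0 by rewrite expf_neq0// gt_eqF.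
  rewrite /scaled /sg; move: (mulfV gm) (sqrr_sign R k).
  rewrite [in X in _ -> X -> _]expr2.
  set sk := (-1) ^+ k; set sm := (-1) ^+ m; set Gm := _ ^+ m; set Gk := _ ^+ k.
  set p := Pw.[_]; set r := Q.[_]; set zz := Zreal _ _ _; set Gi := Gm^-1.
  move=> GG ss h; transitivity (p * (sm * Gm) * sk * Gi).
    by rewrite -[LHS]mulr1 -GG; ring.
  by rewrite -h -[RHS]mulr1 -ss; ring.
have lim : scaled b k m (Zreal v ^~ w) z @[z --> b^'+] --> Pw.[t0] * sg / Q.[t0].
  have QV : (Q.[expR (- z)])^-1 @[z --> b^'+] --> Q.[t0]^-1.
    by apply: cvgV => //; exact: horner_expRN_cvg.
  have Qn : \forall z \near b^'+, Q.[expR (- z)] != 0.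
    by apply: (cvgr_neq0 _ (horner_expRN_cvg (b := b) (p := Q))).
  apply: (@cvg_trans _ (Pw.[expR (- z)] * sg / Q.[expR (- z)] @[z --> b^'+])).
    apply: near_eq_cvg; near=> z.
    rewrite key; last by near: z; exact: nbhs_right_gt.
    rewrite mulrAC divff ?mul1r//; near: z; exact: Qn.
  by apply: cvgM => //; apply: cvgM; [exact: horner_expRN_cvg|exact: cvg_cst].
exists m, (Pw.[t0] * sg / Q.[t0]); split => //.
have P0 : P w != 0.
  apply/eqP => P0.
  have : \forall z \near b^'+, false.
    near=> z; have bz : b < z by near: z; exact: nbhs_right_gt.
    have := qP z (Zfin bz) w; rewrite P0 horner0 qE hornerM horner_exp hornerXsubC.
    move=> /eqP; rewrite !mulf_eq0 expf_eq0 subr_eq0.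
    rewrite [_ == t0]lt_eqF ?andbF ?orbF; last by rewrite ltr_expR ltrN2.
    rewrite [Zreal _ _ _ == 0]gt_eqF ?orbF; last by apply: Zreal_gt0 => //; exact: Zfin.
    apply: contraTT => _; near: z.
    exact: (cvgr_neq0 _ (horner_expRN_cvg (b := b) (p := Q))).
  by move=> /filter_ex[].
rewrite P0/= in Pw0.
rewrite lt_neqAle eq_sym !mulf_neq0 ?invr_eq0 ?signr_eq0//=.
apply: (right_cvg_ge0 _ lim) => z bz; apply: scaled_ge0 => //.
exact: Zreal_ge0 (Zfin bz) w.
Unshelve. all: end_near. Qed.

End Rationality.

(** * The pole order on a component *)

Section Orders.
Variables (R : realType) (E : digraph) (v : vert E) (b : R).
Hypothesis Zfin : forall beta, b < beta -> (Zfun v beta < +oo)%E.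
Variables (k : nat) (m : vert E -> nat) (y : vert E -> R).
Hypothesis y_gt0 : forall w, conn w v -> 0 < y w.
Hypothesis y_lim : forall w, conn w v ->
  scaled b k (m w) (Zreal v ^~ w) z @[z --> b^'+] --> y w.

Notation t0 := (expR (- b)).
Notation edge_count := (@edge_count R E).

(** The limit of Z_{u,v} rescaled by the order n, provided the pole of Z_{u,v} is
not larger than that. *)
Definition order_coef n u : R := (conn u v && (m u == n))%:R * y u.

Lemma order_coef_ge0 n u : 0 <= order_coef n u.
Proof.
rewrite /order_coef; case: (boolP (conn u v)) => [uv|_]; last by rewrite mul0r.
by rewrite mulr_ge0 ?ler0n// ltW// y_gt0.
Qed.

Lemma scaled_Zreal_cvg n u : (conn u v -> n <= m u)%N ->
  scaled b k n (Zreal v ^~ u) z @[z --> b^'+] --> order_coef n u.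
Proof.
rewrite /order_coef; have [uv /(_ isT) nm|uv _] := boolP (conn u v).
  exact: scaled_cvg_lower (y_lim uv).
rewrite mul0r; apply: (@right_cvg_ext _ _ (fun=> 0)); last exact: cvg_cst.
by move=> z bz; rewrite /scaled (Zreal_disconnected _ uv) mulr0.
Qed.

(** Z_{w,v} >= t A_{w,u} Z_{u,v}: a vertex inherits the poles of its successors. *)
Lemma order_arc w u : arc w u -> conn u v -> (m w <= m u)%N.
Proof.
move=> wu uv; have wv : conn w v := connect_trans (connect1 wu) uv.
rewrite leqNgt; apply/negP => mm.
have l1 := scaled_Zreal_cvg (fun _ => ltnW mm).
rewrite /order_coef gtn_eqF// andbF mul0r in l1.
have l2 : expR (- z) * (edge_count w u * scaled b k (m u) (Zreal v ^~ u) z) @[z --> b^'+]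
    --> t0 * (edge_count w u * y u).
  apply: cvgM; first exact: expRN_cvg.
  by apply: cvgM; [exact: cvg_cst|exact: y_lim].
have : t0 * (edge_count w u * y u) <= 0.
  apply: right_cvg_le l2 l1 => z bz.
  have -> : expR (- z) * (edge_count w u * scaled b k (m u) (Zreal v ^~ u) z) =
      scaled b k (m u) (fun x => expR (- x) * (edge_count w u * Zreal v x u)) z.
    by rewrite /scaled; ring.
  apply: scaled_le => //; exact: Zreal_arc (Zfin bz) w u.
by rewrite leNgt !mulr_gt0 ?expR_gt0 ?edge_count_gt0// y_gt0.
Qed.

Lemma order_conn w u : conn w u -> conn u v -> (m w <= m u)%N.
Proof.
move=> /connectP[p]; elim: p w => [|x p IH] w /=; first by move=> _ ->.
move=> /andP[wx pp] ux uv; apply: leq_trans (IH _ pp ux uv).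
apply: order_arc wx _; apply: connect_trans uv.
by apply/connectP; exists p.
Qed.

Lemma order_comp C w u : C \in components E -> w \in C -> u \in C -> conn w v ->
  m w = m u.
Proof.
move=> cC wC uC wv; have uw := comp_conn cC uC wC.
apply/eqP; rewrite eqn_leq (order_conn uw wv) andbT.
exact: order_conn (comp_conn cC wC uC) (connect_trans uw wv).
Qed.

Lemma scaled_one_cvg n : (n <= k)%N ->
  scaled b k n (fun=> 1) z @[z --> b^'+] --> ((k == n)%:R : R).
Proof.
move=> nk; rewrite -[X in _ --> X]mulr1.
apply: scaled_cvg_lower => //.
apply: (@right_cvg_ext _ _ (fun=> 1)); last exact: cvg_cst.
move=> z bz; rewrite /scaled mulr1 divff// expf_neq0// gt_eqF//.
exact: weight_gap_gt0.
Qed.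

(** Z_{v,v} >= 1, since the walk of length 0 contributes 1. *)
Lemma order_v_le : (m v <= k)%N.
Proof.
rewrite leqNgt; apply/negP => km; have vv : conn v v := connect0 _ _.
have := scaled_Zreal_cvg (fun _ => ltnW km).
rewrite /order_coef gtn_eqF// andbF mul0r => l1.
have : (k == k)%:R <= 0 :> R.
  apply: right_cvg_le (scaled_one_cvg (leqnn k)) l1 => z bz.
  apply: scaled_le => //; exact: Zreal_v_ge1 (Zfin bz).
by rewrite eqxx ler10.
Qed.

(** The leading terms of the equation z = e_v + t A z. *)
Lemma order_coef_balance n w : conn w v -> (n <= m w)%N ->
  order_coef n w = ((w == v) && (k == n))%:R + t0 * kernel_app edge_count (order_coef n) w.
Proof.
move=> wv nm.
have nk : (n <= k)%N by apply: leq_trans nm (leq_trans (order_conn wv (connect0 _ _)) order_v_le).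
apply: (right_cvg_unique (scaled_Zreal_cvg (fun _ => nm))).
apply: (@right_cvg_ext _ _ (fun z => (w == v)%:R * scaled b k n (fun=> 1) z +
   expR (- z) * \sum_u edge_count w u * scaled b k n (Zreal v ^~ u) z)).
  move=> z bz; rewrite /scaled mulr1 (Zreal_rec (Zfin bz)) mulrDr; congr (_ + _).
    by rewrite mulrC.
  rewrite [RHS]mulrCA; congr (_ * _); rewrite /kernel_app mulr_sumr.
  by apply: eq_bigr => u _; rewrite mulrCA.
rewrite -mulnb natrM; apply: cvgD.
  by apply: cvgM; [exact: cvg_cst|exact: scaled_one_cvg].
apply: cvgM; first exact: expRN_cvg.
apply: cvg_bigsum => u _; have [wu|nwu] := boolP (arc w u).
  apply: cvgM; first exact: cvg_cst.
  by apply: scaled_Zreal_cvg => uv; apply: leq_trans nm (order_arc wu uv).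
have -> : edge_count w u = 0.
  by apply/le_anti; rewrite edge_count_ge0 leNgt edge_count_gt0 nwu.
by under eq_fun do rewrite mul0r; rewrite mul0r; exact: cvg_cst.
Qed.

(** The recursion for pole orders.  If something outside C (or v itself) has
already the pole order of C, the leading coefficients y on C satisfy
A_C y <= lam y with a strict inequality somewhere, so C is not critical.
Otherwise A_C y = lam y, so C is critical.  In that case a positive left
eigenvector l of A_C gives
(1 - t lam) (l z_C) = l e_v + t l A_{C,out} z_out, where 1 - t lam = lam (t0 - t),
and therefore the order drops by exactly one when leaving C. *)
Lemma component_order C w0 : C \in components E -> w0 \in C -> conn w0 v ->
  let c := (rho R C == expR b) : nat in
  [/\ forall w u, w \in C -> u \notin C -> arc w u -> conn u v -> (m w0 + c <= m u)%N,
      v \in C -> (m w0 + c <= k)%N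
    & (v \in C /\ k = m w0 + c)%N \/
      exists w u, [/\ w \in C, u \notin C, arc w u, conn u v & m u = (m w0 + c)%N]].
Proof.
move=> cC w0C w0v; set n := m w0.
have Cv w : w \in C -> conn w v.
  by move=> wC; apply: connect_trans (comp_conn cC wC w0C) w0v.
have mC w : w \in C -> m w = n by move=> wC; rewrite /n (order_comp cC w0C wC).
have leadC w : w \in C -> order_coef n w = y w.
  by move=> wC; rewrite /order_coef Cv// mC// eqxx mul1r.
have lamt : expR b * t0 = 1 by rewrite -expRD subrr expR0.
have nout w u : w \in C -> u \notin C -> arc w u -> conn u v -> (n <= m u)%N.
  by move=> wC _ wu uv; rewrite -(mC w wC); exact: order_arc.
have nk : v \in C -> (n <= k)%N by move=> /mC <-; exact: order_v_le.
pose out n w := \sum_(u | u \notin C) edge_count w u * order_coef n u.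
have out_ge0 n' w : 0 <= out n' w.
  by apply: sumr_ge0 => u _; rewrite mulr_ge0 ?edge_count_ge0 ?order_coef_ge0.
have bal w : w \in C ->
    y w = ((w == v) && (k == n))%:R + t0 * (\sum_(u in C) edge_count w u * y u + out n w).
  move=> wC; rewrite -leadC// order_coef_balance ?Cv ?mC// (kernel_app_split C).
  by congr (_ + t0 * (_ + _)); apply: eq_bigr => u uC; rewrite leadC.
have balle w : w \in C -> \sum_(u in C) edge_count w u * y u <= expR b * y w.
  move=> wC; rewrite [in leRHS]bal// mulrDr mulrA lamt mul1r.
  by rewrite addrCA lerDl addr_ge0 ?out_ge0// mulr_ge0 ?ler0n ?expR_ge0.
have y0 w : w \in C -> 0 < y w by move=> /Cv; exact: y_gt0.
(* does the outside of C (or the source at v) contribute at the order of C? *)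
have [bad|nbad] := pselect ((v \in C /\ k = n) \/
    exists w u, [/\ w \in C, u \notin C, arc w u, conn u v & m u = n]).
  have rlt : rho R C < expR b.
    apply: (rho_lt_of_strict_supersolution cC (expR_gt0 b) y0 balle).
    case: bad => [[vC kn]|[w [u [wC uC wu uv mu]]]].
      exists v => //; rewrite [in ltRHS]bal// kn !eqxx mulrDr mulrA lamt mul1r.
      by rewrite addrCA ltrDl ltr_wpDr ?out_ge0// mulr1 expR_gt0.
    exists w => //; rewrite [in ltRHS]bal// mulrDr mulrA lamt mul1r.
    rewrite addrCA ltrDl ltr_wpDl ?mulr_ge0 ?ler0n ?expR_ge0//.
    rewrite /out (bigD1 u)//= ltr_wpDr//.
      by apply: sumr_ge0 => x _; rewrite mulr_ge0 ?edge_count_ge0 ?order_coef_ge0.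
    by rewrite mulr_gt0 ?edge_count_gt0// /order_coef uv mu eqxx mul1r y_gt0.
  rewrite lt_eqF//= addn0; split => //.
have out0 w : w \in C -> out n w = 0.
  move=> wC; apply: big1 => u uC; have [wu|nwu] := boolP (0 < edge_count w u).
    rewrite /order_coef; have [uv|] := boolP (conn u v); last by rewrite mul0r mulr0.
    have [mu|_] := eqVneq (m u) n; last by rewrite mul0r mulr0.
    by exfalso; apply: nbad; right; exists w, u; split => //; rewrite -(edge_count_gt0 R).
  by rewrite (edge_count_eq0 nwu) mul0r.
have baleq w : w \in C -> \sum_(u in C) edge_count w u * y u = expR b * y w.
  move=> wC; rewrite [in RHS]bal// out0// addr0 mulrDr mulrA lamt mul1r.
  rewrite (_ : _ && _ = false) ?mulr0 ?add0r//.
  by apply/negP => /andP[/eqP wv /eqP kn]; apply: nbad; left; rewrite -wv.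
have req : rho R C = expR b.
  by apply: (rho_of_positive_eigenvector cC _ y0 baleq); exact: expR_ge0.
rewrite req eqxx /= addn1.
have nout' w u : w \in C -> u \notin C -> arc w u -> conn u v -> (n < m u)%N.
  move=> wC uC wu uv; rewrite ltn_neqAle (nout w u)// andbT.
  by apply/eqP => mu; apply: nbad; right; exists w, u.
have nk' : v \in C -> (n < k)%N.
  move=> vC; rewrite ltn_neqAle nk// andbT.
  by apply/eqP => kn; apply: nbad; left.
split => //.
apply: contrapT => none.
have [l [l0 lE]] := left_eigenvector cC y0 baleq.
have lhs : expR b * \sum_(w in C) l w * scaled b k n (Zreal v ^~ w) z @[z --> b^'+]
    --> expR b * \sum_(w in C) l w * y w.
  apply: cvgM; first exact: cvg_cst.
  apply: cvg_bigsum => w wC; apply: cvgM; first exact: cvg_cst.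
  by rewrite -(leadC w wC); apply: scaled_Zreal_cvg; rewrite mC.
have rhs : \sum_(w in C) l w * ((w == v)%:R * scaled b k n.+1 (fun=> 1) z +
    expR (- z) * \sum_(u | u \notin C) edge_count w u * scaled b k n.+1 (Zreal v ^~ u) z)
    @[z --> b^'+] --> \sum_(w in C) l w * 0.
  apply: cvg_bigsum => w wC; apply: cvgM; first exact: cvg_cst.
  rewrite -[X in _ --> X]addr0; apply: cvgD.
    have [wv|_] := eqVneq w v; last first.
      by under eq_fun do rewrite mul0r; exact: cvg_cst.
    under eq_fun do rewrite mul1r.
    have vC : v \in C by rewrite -wv.
    rewrite (_ : 0 = (k == n.+1)%:R); first exact: scaled_one_cvg (nk' vC).
    by case: eqP => // kn; exfalso; apply: none; left.
  rewrite -[X in _ --> X](mulr0 t0); apply: cvgM; first exact: expRN_cvg.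
  rewrite [X in _ --> X](_ : 0 = \sum_(u | u \notin C) 0); last by rewrite big1.
  apply: (@cvg_bigsum R R b^'+ _ _ (fun u => u \notin C)
    (fun u z => edge_count w u * scaled b k n.+1 (Zreal v ^~ u) z) (fun=> 0)) => u uC.
  have [wu|nwu] := boolP (0 < edge_count w u); last first.
    rewrite (edge_count_eq0 nwu).
    by under eq_fun do rewrite mul0r; exact: cvg_cst.
  have awu : arc w u by rewrite -(edge_count_gt0 R).
  rewrite -[X in _ --> X](mulr0 (edge_count w u)); apply: cvgM; first exact: cvg_cst.
  rewrite [X in _ --> X](_ : 0 = order_coef n.+1 u).
    by apply: scaled_Zreal_cvg => uv; exact: nout' wC uC awu uv.
  rewrite /order_coef; have [uv|] := boolP (conn u v); last by rewrite mul0r.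
  have [mu|_] := eqVneq (m u) n.+1; last by rewrite mul0r.
  by exfalso; apply: none; right; exists w, u.
have : expR b * \sum_(w in C) l w * y w = \sum_(w in C) l w * 0.
  apply: right_cvg_unique rhs; apply: right_cvg_ext lhs => z bz.
  pose S := \sum_(w in C) l w * Zreal v z w.
  pose G := weight_gap b z ^+ k / weight_gap b z ^+ n.+1.
  have SE : S = \sum_(w in C) l w * ((w == v)%:R +
      expR (- z) * \sum_(u | u \notin C) edge_count w u * Zreal v z u) + expR (- z) * expR b * S.
    transitivity (\sum_(w in C) (l w * ((w == v)%:R +
        expR (- z) * \sum_(u | u \notin C) edge_count w u * Zreal v z u) +
        l w * (expR (- z) * \sum_(u in C) edge_count w u * Zreal v z u))).
      by apply: eq_bigr => w _; rewrite {1}(Zreal_rec (Zfin bz)) (kernel_app_split C); ring.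
    rewrite big_split/=; congr (_ + _).
    rewrite -mulrA /S mulr_sumr mulr_sumr.
    transitivity (\sum_(u in C) expR (- z) * (\sum_(w in C) l w * edge_count w u) * Zreal v z u).
      transitivity (\sum_(w in C) \sum_(u in C) expR (- z) * l w * edge_count w u * Zreal v z u).
        apply: eq_bigr => w _; rewrite mulrCA !mulr_sumr; apply: eq_bigr => u _.
        by rewrite !mulrA.
      rewrite exchange_big/=; apply: eq_bigr => u _; rewrite mulr_sumr mulr_suml.
      by apply: eq_bigr => w _; rewrite !mulrA.
    by apply: eq_bigr => u uC; rewrite lE// !mulrA.
  have -> : \sum_(w in C) l w * scaled b k n (Zreal v ^~ w) z = weight_gap b z * (G * S).
    rewrite /S !mulr_sumr; apply: eq_bigr => w _.
    by rewrite -scaledS// /scaled -/G; ring.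
  transitivity (G * (S - expR (- z) * expR b * S)).
    rewrite /weight_gap.
    have -> : S - expR (- z) * expR b * S =
        (expR b * t0 - expR (- z) * expR b) * S.
      by rewrite lamt mulrBl mul1r.
    by ring.
  rewrite {1}SE addrK mulr_sumr; apply: eq_bigr => w _.
  rewrite mulrCA; congr (_ * _); rewrite mulrDr; congr (_ + _).
    by rewrite /scaled mulr1 mulrC.
  by rewrite mulrCA; congr (_ * _); rewrite mulr_sumr; apply: eq_bigr => u _; rewrite mulrCA.
rewrite [RHS]big1 => [/eqP|w _]; last by rewrite mulr0.
apply/negP; rewrite gt_eqF// mulr_gt0 ?expR_gt0//.
rewrite (bigD1 w0)//= ltr_wpDr ?mulr_gt0 ?l0 ?y0//.
by apply: sumr_ge0 => w /andP[wC _]; rewrite mulr_ge0// ltW// ?l0 ?y0.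
Qed.

End Orders.

(** * Pole orders and paths of components *)

Section MaximalPaths.
Variables (R : realType) (E : digraph) (v : vert E) (C0 : {set vert E}).
Hypotheses (cC0 : C0 \in components E) (vC0 : v \in C0).
Variables (b : R) (k : nat) (m : vert E -> nat).
Hypothesis bE : fine (beta_crit R v) = b.
Notation crt C := (rho R C == expR b).
Hypothesis order : forall C w0, C \in components E -> w0 \in C -> conn w0 v ->
  [/\ forall w u, w \in C -> u \notin C -> arc w u -> conn u v ->
        (m w0 + crt C <= m u)%N,
      v \in C -> (m w0 + crt C <= k)%N
    & (v \in C /\ k = m w0 + crt C)%N \/
      exists w u, [/\ w \in C, u \notin C, arc w u, conn u v
                    & m u = (m w0 + crt C)%N]].

Notation B := (Bgraph C0).

Lemma Bvert_comp (X : vert B) : val X \in components E.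
Proof. by have := valP X; rewrite inE => /andP[]. Qed.

Lemma Bvert_conn (X : vert B) w : w \in val X -> conn w v.
Proof.
move=> wX; have := valP X; rewrite inE => /andP[cX].
exact: reach_compC cX cC0 wX vC0.
Qed.

Lemma Bvert_of w : conn w v -> exists X : vert B, val X = comp_of w.
Proof.
move=> wv; have h : comp_of w \in Bverts C0.
  rewrite inE comp_of_comp/=; apply/reachP; exists w, v; split => //.
  exact: mem_comp_of.
by exists (exist (fun C => C \in Bverts C0) _ h).
Qed.

Lemma Bedge_arc (e : edge B) : exists w u,
  [/\ w \in val (src e), u \in val (rng e), u \notin val (src e) & arc w u].
Proof.
have := valP e => /andP[ne /existsP[f /andP[fs fr]]].
exists (src f), (rng f); split => //; last first.
  by apply/existsP; exists f; rewrite !eqxx.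
apply/negP => fr'; move/eqP: ne; apply.
exact: comp_eq (Bvert_comp (src e)) (Bvert_comp (rng e)) fr' fr.
Qed.

Lemma pverts_conn (X : vert B) q Y : is_walk X q -> Y \in pverts (X, q) ->
  forall a c, a \in val X -> c \in val Y -> conn a c.
Proof.
elim: q X => [|e q IH] X /=.
  by move=> _; rewrite mem_seq1 => /eqP -> a c; exact: comp_conn (Bvert_comp X).
move=> /andP[/eqP <- wq]; rewrite in_cons => /orP[/eqP -> a c|Yq a c aX cY].
  exact: comp_conn (Bvert_comp _).
have [w [u [wX uX' _ wu]]] := Bedge_arc e.
apply: connect_trans (comp_conn (Bvert_comp _) aX wX) _.
exact: connect_trans (connect1 wu) (IH _ wq Yq u c uX' cY).
Qed.

Lemma crit_nil (X : vert B) : #|crit R v (X, [::])| = crt (val X).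
Proof.
rewrite /crit bE (_ : [set _ in _ | _]%SET = if crt (val X) then [set X]%SET else finset.set0).
  by case: ifP => _; rewrite ?cards1 ?cards0.
apply/setP => Y; rewrite [LHS]inE mem_seq1.
case: ifP => cX; [rewrite finset.in_set1|rewrite finset.in_set0];
  by case: eqP => // ->; rewrite cX.
Qed.

Lemma crit_cons (X : vert B) e q : src e = X ->
  crit R v (X, e :: q) =
  ((if crt (val X) then [set X]%SET else finset.set0) :|: crit R v (rng e, q))%SET.
Proof.
move=> eX; rewrite /crit bE; apply/setP => Y; rewrite [LHS]inE finset.in_setU [in RHS]inE.
rewrite [Y \in pverts (X, _)]in_cons andb_orl; congr (_ || _).
case: ifP => cX; [rewrite finset.in_set1|rewrite finset.in_set0];
  by case: eqP => // ->; rewrite cX.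
Qed.

(** By induction along the path: leaving a component costs one order if it is
critical. *)
Lemma crit_le_order (X : vert B) q : is_walk X q -> val (pend (X, q)) = C0 ->
  forall w, w \in val X -> (m w + #|crit R v (X, q)| <= k)%N.
Proof.
elim: q X => [|e q IH] X /=.
  move=> _ X0 w wX; rewrite crit_nil.
  have [_ h _] := order (Bvert_comp X) wX (Bvert_conn wX).
  by apply: h; rewrite [val X]X0.
move=> /andP[/eqP eX wq] eC0 w wX; rewrite crit_cons//.
have [w' [u [w'X uX' uX wu]]] := Bedge_arc e; rewrite (eX : src e = X) in w'X uX.
have [h _ _] := order (Bvert_comp X) wX (Bvert_conn wX).
have mu := h w' u w'X uX wu (Bvert_conn uX').
apply: leq_trans (IH _ wq eC0 u uX').
apply: (@leq_trans (m w + crt (val X) + #|crit R v (rng e, q)|)%N); last first.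
  by rewrite leq_add2r.
rewrite -addnA leq_add2l; apply: leq_trans (leq_card_setU _ _) _.
by rewrite leq_add2r; case: ifP => _; rewrite ?cards1 ?cards0.
Qed.

(** Follow, from component to component, a successor for which the recursion of the
pole orders is an equality.  The set of reachable vertices shrinks strictly, which
ends the construction and also shows that no component is met twice, so that the
cardinal of the set of critical components counts them along the path. *)
Lemma order_path w : conn w v -> exists (X : vert B) q,
  [/\ val X = comp_of w, is_walk X q, val (pend (X, q)) = C0
    & (m w + #|crit R v (X, q)| = k)%N].
Proof.
have [N] := ubnP #|[set u | conn w u]%SET|.
elim: N w => // N IH w wN wv.
have [X XE] := Bvert_of wv.
have wX : w \in val X by rewrite XE mem_comp_of.
have [_ _ [[vX kE]|[w' [u [w'X uX wu uv mu]]]]] :=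
  order (Bvert_comp X) wX (Bvert_conn wX).
  exists X, [::]; split => //; last by rewrite crit_nil -kE.
  exact: comp_eq (Bvert_comp X) cC0 vX vC0.
have wu' : conn w u := connect_trans (comp_conn (Bvert_comp X) wX w'X) (connect1 wu).
have nuw : ~~ conn u w.
  by apply: contraNN uX => uw; exact: comp_closed (Bvert_comp X) wX wu' uw.
have [|Y [q [YE Yq qC0 mY]]] := IH u _ uv.
  rewrite -ltnS; apply: leq_trans wN; rewrite ltnS; apply: proper_card.
  apply/properP; split.
    by apply/fintype.subsetP => x; rewrite !inE; exact: connect_trans.
  by exists w; rewrite inE ?/conn ?connect0.
have uY : u \in val Y by rewrite YE mem_comp_of.
have XY : Badj (val X) (val Y).
  rewrite /Badj; apply/andP; split.
    by apply: contraNN uX => /eqP ->.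
  move/existsP: wu => [f /andP[/eqP fs /eqP fr]].
  by apply/existsP; exists f; rewrite fs fr w'X.
pose e : edge B := exist (fun x : Bvert C0 * Bvert C0 => Badj (val x.1) (val x.2)) (X, Y) XY.
exists X, (e :: q); split => //=; first by rewrite eqxx.
rewrite crit_cons// cardsU disjoint_setI0 ?cards0 ?subn0.
  transitivity (m w + crt (val X) + #|crit R v (rng e, q)|)%N; last by rewrite -mu.
  by rewrite addnA; congr (_ + _ + _)%N; case: ifP => _; rewrite ?cards1 ?cards0.
case: ifP => _; last by rewrite -setI_eq0 finset.set0I.
rewrite disjoints1 inE negb_and; apply/orP; left.
apply: contraNN nuw => Xq.
exact: pverts_conn Yq Xq _ _ uY wX.
Qed.

(** The number of critical components on a path from w is at most k - m(w), with
equality for some path; so a path starting at C is maximal iff m is minimal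
on C. *)
Lemma maximal_path_order C w : C \in components E -> w \in C -> conn w v ->
  (exists mu : fpath B, Bpaths C mu /\ maximal_path R v mu) <->
  (forall u, conn u v -> (m w <= m u)%N).
Proof.
move=> cC wC wv; split.
  move=> [[X q] [[/= qX XC _] [[_ _ qC0] qmax]]] u uv.
  have [Y [q' [YE Yq' q'C0 mY]]] := order_path uv.
  have := qmax (Y, q'); rewrite -(leq_add2l (m u)) mY => /(_ _) le1.
  have XC' : val X = C by apply/eqP.
  have wX : w \in val X by rewrite XC'.
  have := crit_le_order qX (eqP qC0) wX => le2.
  have/le1 : Bpaths_to (Y, q') by split => //; apply/eqP.
  by move=> /(leq_trans le2); rewrite leq_add2r.
move=> mmin; have [X [q [XE Xq qC0 mX]]] := order_path wv.
exists (X, q); split.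
  by split => //; apply/eqP; rewrite // XE (comp_ofE cC wC).
split; first by split => //; apply/eqP.
move=> [Y q'] [/= Yq' _ /eqP q'C0].
have [u uY] := comp_neq0 (Bvert_comp Y).
have := crit_le_order Yq' q'C0 uY; rewrite -mX => le1.
rewrite -(leq_add2l (m w)); apply: leq_trans le1.
by rewrite leq_add2r mmin// (Bvert_conn uY).
Qed.

End MaximalPaths.

(** * Nonnegative eigenvectors of the adjacency matrix *)

Section HarmonicVectors.
Variables (R : realType) (E : digraph).
Implicit Types (C : {set vert E}) (w u : vert E).
Notation edge_count := (@edge_count R E).

Definition harmonic (lam : R) (x : vert E -> R) : Prop :=
  forall w, kernel_app edge_count x w = lam * x w.

Section Positive.
Variables (lam : R) (x : vert E -> R).
Hypotheses (lam_gt0 : 0 < lam) (x_ge0 : forall w, 0 <= x w)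
           (x_harm : harmonic lam x).

Lemma harmonic_back w u : conn w u -> 0 < x u -> 0 < x w.
Proof.
move=> /connectP[p]; elim: p w => [|y p IH] w /=; first by move=> _ ->.
move=> /andP[wy pp] up xu; have xy := IH _ pp up xu.
rewrite -(pmulr_rgt0 _ lam_gt0) -x_harm.
by apply: (kernel_app_gt0 (@edge_count_ge0 R E) x_ge0 _ xy); rewrite edge_count_gt0.
Qed.

Let out_ge0 C w : 0 <= \sum_(u | u \notin C) edge_count w u * x u.
Proof. by apply: sumr_ge0 => u _; rewrite mulr_ge0 ?edge_count_ge0. Qed.

Lemma harmonic_le C w : \sum_(u in C) edge_count w u * x u <= lam * x w.
Proof. by rewrite -x_harm (kernel_app_split C) lerDl. Qed.

Lemma harmonic_rho_lt C w u : C \in components E ->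
  (forall w, w \in C -> 0 < x w) -> w \in C -> u \notin C -> arc w u ->
  0 < x u -> rho R C < lam.
Proof.
move=> cC x0 wC uC wu xu; apply: (rho_lt_of_strict_supersolution cC lam_gt0 x0).
  by move=> z _; exact: harmonic_le.
exists w => //; rewrite -x_harm (kernel_app_split C) ltrDl (bigD1 u)//=.
rewrite ltr_wpDr ?mulr_gt0 ?edge_count_gt0//.
by apply: sumr_ge0 => z _; rewrite mulr_ge0 ?edge_count_ge0.
Qed.

(** A nonnegative eigenvector that lives on a critical component vanishes on
everything this component points to, otherwise A_C x <= lam x would be strict
somewhere. *)
Lemma harmonic_critical_eq C : C \in components E -> rho R C = lam ->
  forall w, w \in C -> \sum_(u in C) edge_count w u * x u = lam * x w.
Proof.
move=> cC rC w wC.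
have [xw|xw] := ltP 0 (x w); last first.
  have xw0 : x w = 0 by apply/le_anti; rewrite xw x_ge0.
  apply/le_anti; rewrite harmonic_le xw0 mulr0.
  by apply: sumr_ge0 => z _; rewrite mulr_ge0 ?edge_count_ge0.
have x0 z : z \in C -> 0 < x z.
  by move=> zC; apply: harmonic_back xw; exact: comp_conn cC zC wC.
rewrite -x_harm (kernel_app_split C) [X in _ + X]big1 ?addr0// => u uC.
have [wu|nwu] := boolP (0 < edge_count w u); last first.
  by rewrite (edge_count_eq0 nwu) mul0r.
rewrite (_ : x u = 0) ?mulr0//; apply/le_anti; rewrite x_ge0 andbT leNgt.
apply/negP => xu; rewrite edge_count_gt0 in wu.
by have := harmonic_rho_lt cC x0 wC uC wu xu; rewrite rC ltxx.
Qed.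

End Positive.

(** Subtract from c y, with c the largest ratio x / y on C, the vector x: the
difference is a nonnegative eigenvector with a zero entry, and zeros propagate
along arrows. *)
Lemma eigenvector_proportional C lam (x y : vert E -> R) : C \in components E ->
  (forall w, w \in C -> 0 <= x w) -> (forall w, w \in C -> 0 < y w) ->
  (forall w, w \in C -> \sum_(u in C) edge_count w u * x u = lam * x w) ->
  (forall w, w \in C -> \sum_(u in C) edge_count w u * y u = lam * y w) ->
  exists2 c, 0 <= c & forall w, w \in C -> x w = c * y w.
Proof.
move=> cC x0 y0 hx hy; have [w0 w0C] := comp_neq0 cC.
case: (@Order.TotalTheory.arg_maxP _ R _ w0 (mem C) (fun w => x w / y w) w0C) => w1 w1C w1max.
pose c := x w1 / y w1.
have c0 : 0 <= c by rewrite divr_ge0 ?x0// ltW// y0.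
exists c => //.
pose d w := c * y w - x w.
have d0 w : w \in C -> 0 <= d w.
  by move=> wC; rewrite subr_ge0 -ler_pdivrMr ?y0//; exact: w1max.
have dE w : w \in C -> \sum_(u in C) edge_count w u * d u = lam * d w.
  move=> wC; rewrite /d mulrBr mulrCA -hy// -hx// mulr_sumr -sumrB.
  by apply: eq_bigr => u _; rewrite mulrBr mulrCA.
move=> w wC; apply/eqP; rewrite eq_sym -subr_eq0 -/(d w).
apply: (comp_conn_ind (P := fun w => d w == 0) cC w1C) => //.
  by rewrite /d /c mulfVK ?subrr// gt_eqF// y0.
move=> p q pC qC pq /eqP dp.
have S0 : \sum_(u in C) edge_count p u * d u = 0 by rewrite dE// dp mulr0.
have := psumr_eq0P _ S0; move=> /(_ _ q qC)/eqP.
rewrite mulf_eq0 gt_eqF ?edge_count_gt0//=; apply => u uC.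
by rewrite mulr_ge0 ?edge_count_ge0 ?d0.
Qed.

End HarmonicVectors.

Section Decomposition.
Variables (R : realType) (E : digraph) (v : vert E) (b : R).
Hypotheses (b_gt0 : 0 < b) (bE : beta_crit R v = b%:E).
Notation edge_count := (@edge_count R E).
Notation lam := (expR b).
Let lam_gt0 : 0 < lam := expR_gt0 b.

Lemma pi_v_mcP C : reflect
  [/\ C \in components E, rho R C = lam,
      forall C', C' \in components E -> C' != C -> reach C' C -> rho R C' < lam
    & reach C (pred1 v)]
  (C \in pi_v_mc R v).
Proof.
rewrite !finset.in_set /minimal_component /beta_comp bE; apply: (iffP idP).
  move=> /andP[/andP[/andP[cC /forallP mC] r1] /andP[rv /eqP[lnr]]].
  have rE : rho R C = lam by rewrite -lnr lnK// posrE (lt_trans ltr01).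
  split => // C' cC' nC rC; rewrite -rE.
  by have := mC C'; rewrite cC' nC rC.
move=> [cC rE mC rv]; rewrite cC rE expRK rv eqxx expR_gt1 b_gt0 !andbT/=.
apply/forallP => C'; apply/implyP => cC'; apply/implyP => nC.
by apply/implyP; exact: mC.
Qed.

Variables (x : vert E -> R) (X : {set vert E} -> vert E -> R).
Hypotheses (x_ge0 : forall w, 0 <= x w) (x_harm : harmonic lam x)
  (x_conn : forall w, 0 < x w -> conn w v).
Hypotheses
  (X_ge0 : forall C, C \in pi_v_mc R v -> forall w, 0 <= X C w)
  (X_harm : forall C, C \in pi_v_mc R v -> harmonic lam (X C))
  (X_gt0 : forall C, C \in pi_v_mc R v -> forall w, w \in C -> 0 < X C w)
  (X_supp : forall C, C \in pi_v_mc R v -> forall w, X C w != 0 ->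
      exists2 u, u \in C & conn w u).

(** If the vector of C were nonzero on C', then C' would reach C, and minimality of
C would make the spectral radius of C' smaller than that of C. *)
Lemma component_vector_vanishes C C' w : C \in pi_v_mc R v -> C' \in pi_v_mc R v -> C' != C ->
  w \in C' -> X C w = 0.
Proof.
move=> pC pC' nC wC'; apply/eqP/negPn/negP => /(X_supp pC)[u uC wu].
have [cC rC mC _] := pi_v_mcP _ pC; have [cC' rC' _ _] := pi_v_mcP _ pC'.
have : rho R C' < lam by apply: mC => //; apply/reachP; exists w, u.
by rewrite rC' ltxx.
Qed.

Lemma sum_on_component (c : {set vert E} -> R) C w : C \in pi_v_mc R v ->
  w \in C -> \sum_(C' in pi_v_mc R v) c C' * X C' w = c C * X C w.
Proof.
move=> pC wC; rewrite (bigD1 C)//= big1 ?addr0// => C' /andP[pC' nC].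
by rewrite (component_vector_vanishes pC' pC _ wC) ?mulr0// eq_sym.
Qed.

(** Choose the coefficients so that y = x - sum_C c_C X_C vanishes on every C.
Then y = 0 by a maximum principle: the set where |y| / x is maximal is closed
under the arrows inside the support of x, and it therefore contains a component
without arrows to the rest of the support.  Such a component is critical and
minimal, and y vanishes on it. *)
Lemma harmonic_decomposition : exists c : {set vert E} -> R,
  (forall C, C \in pi_v_mc R v -> 0 <= c C) /\
  (forall w, x w = \sum_(C in pi_v_mc R v) c C * X C w).
Proof.
have [c hc] : {c : {set vert E} -> R & forall C, C \in pi_v_mc R v ->
    0 <= c C /\ forall w, w \in C -> x w = c C * X C w}.
  apply: (@choice _ _ (fun C c => C \in pi_v_mc R v ->
    0 <= c /\ forall w, w \in C -> x w = c * X C w)) => C.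
  have [pC|npC] := boolP (C \in pi_v_mc R v); last by exists 0.
  have [cC rC _ _] := pi_v_mcP _ pC.
  have [||||c c0 hc] := @eigenvector_proportional R E C lam x (X C) cC.
  - by move=> w _; exact: x_ge0.
  - exact: X_gt0.
  - exact: harmonic_critical_eq.
  - by apply: harmonic_critical_eq => //; [exact: X_ge0|exact: X_harm].
  by exists c.
have c0 C : C \in pi_v_mc R v -> 0 <= c C by move=> /hc[].
exists c; split => //.
pose y w := x w - \sum_(C in pi_v_mc R v) c C * X C w.
have y_harm : harmonic lam y.
  move=> w; rewrite kernel_appB x_harm /y mulrBr; congr (_ - _).
  rewrite /kernel_app; under eq_bigr do rewrite mulr_sumr.
  rewrite exchange_big/= mulr_sumr; apply: eq_bigr => C pC.
  rewrite mulrCA -X_harm// /kernel_app mulr_sumr.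
  by apply: eq_bigr => u _; rewrite mulrCA.
have y_P C w : C \in pi_v_mc R v -> w \in C -> y w = 0.
  by move=> pC wC; rewrite /y (sum_on_component _ pC wC) -(hc C pC).2// subrr.
have y_supp w : x w = 0 -> y w = 0.
  move=> xw; rewrite /y xw sub0r big1 ?oppr0// => C pC.
  have [->|Xw] := eqVneq (X C w) 0; first by rewrite mulr0.
  have [u uC wu] := X_supp pC Xw.
  have [->|cn] := eqVneq (c C) 0; first by rewrite mul0r.
  have xu : 0 < x u.
    by rewrite (hc C pC).2// mulr_gt0 ?(X_gt0 pC)// lt_neqAle eq_sym cn c0.
  by have := harmonic_back lam_gt0 x_ge0 x_harm wu xu; rewrite xw ltxx.
suff y0 w : y w = 0 by move=> w; apply/eqP; rewrite -subr_eq0 -/(y w) y0.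
apply/eqP/negPn/negP => yw.
have xw : 0 < x w.
  by rewrite lt_neqAle x_ge0 andbT; apply: contraNN yw => /eqP xw; rewrite y_supp.
case: (@Order.TotalTheory.arg_maxP _ R _ w (fun w => 0 < x w) (fun w => `|y w| / x w) xw)
  => w1 xw1 w1max.
pose M := `|y w1| / x w1.
have M0 : 0 < M.
  apply: lt_le_trans (w1max w xw).
  by rewrite divr_gt0// normr_gt0.
have yM u : `|y u| <= M * x u.
  have [xu|xu] := ltP 0 (x u); first by rewrite -ler_pdivrMr//; exact: w1max.
  have xu0 : x u = 0 by apply/le_anti; rewrite xu x_ge0.
  by rewrite y_supp// xu0 mulr0 normr0.
pose Z := [pred w | (0 < x w) && (`|y w| == M * x w)].
have Zarc p q : arc p q -> 0 < x q -> p \in Z -> q \in Z.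
  move=> pq xq /andP[xp /eqP yp]; apply/andP; split => //.
  have S0 : \sum_u edge_count p u * (M * x u - `|y u|) = 0.
    apply/le_anti/andP; split; last first.
      by apply: sumr_ge0 => u _; rewrite mulr_ge0 ?edge_count_ge0// subr_ge0.
    rewrite (_ : \sum_u _ = lam * (M * x p) - \sum_u `|edge_count p u * y u|).
      rewrite -yp -[lam]ger0_norm ?expR_ge0// -normrM -y_harm subr_le0.
      exact: ler_norm_sum.
    rewrite mulrCA -x_harm /kernel_app mulr_sumr -sumrB; apply: eq_bigr => u _.
    by rewrite normrM (ger0_norm (edge_count_ge0 _ _ _)) mulrBr mulrCA.
  have := psumr_eq0P _ S0; move=> /(_ _ q isT)/eqP.
  rewrite mulf_eq0 gt_eqF ?edge_count_gt0//= subr_eq0 eq_sym; apply => u _.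
  by rewrite mulr_ge0 ?edge_count_ge0// subr_ge0.
have w1Z : w1 \in Z by apply/andP; split => //; rewrite /M divfK// gt_eqF.
(* a point of Z that reaches as little of the support as possible lies in a
   component without exits inside the support *)
pose N w := #|[set u | conn w u && (0 < x u)]%SET|.
case: (@arg_minnP _ w1 (mem Z) N w1Z) => w2 w2Z w2min.
have /andP[xw2 _] := w2Z.
pose C := comp_of w2.
have cC : C \in components E := comp_of_comp w2.
have w2C : w2 \in C := mem_comp_of w2.
have xC u : u \in C -> 0 < x u.
  by move=> uC; apply: (harmonic_back lam_gt0 x_ge0 x_harm) xw2; exact: comp_conn cC uC w2C.
have CZ u : u \in C -> u \in Z.
  apply: (comp_conn_ind (P := fun u => u \in Z) cC w2C) => //.
  by move=> p q _ qC pq; apply: Zarc pq (xC _ qC).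
have Cterm p q : p \in C -> q \notin C -> arc p q -> x q = 0.
  move=> pC qC pq; apply/le_anti; rewrite x_ge0 andbT leNgt; apply/negP => xq.
  have w2q : conn w2 q := connect_trans (comp_conn cC w2C pC) (connect1 pq).
  have := w2min q (Zarc p q pq xq (CZ p pC)); rewrite leqNgt => /negP; apply.
  apply: proper_card; apply/properP; split.
    apply/fintype.subsetP => u; rewrite !inE => /andP[qu ->]; rewrite andbT.
    exact: connect_trans w2q qu.
  exists w2; first by rewrite inE /conn connect0 xw2.
  rewrite inE xw2 andbT; apply: contraNN qC => qw2.
  exact: comp_closed cC w2C w2q qw2.
have rC : rho R C = lam.
  apply: (rho_of_positive_eigenvector cC _ xC); first exact: expR_ge0.
  move=> p pC; rewrite -x_harm (kernel_app_split C) [X in _ + X]big1 ?addr0// => q qC.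
  have [pq|npq] := boolP (0 < edge_count p q).
    by rewrite (Cterm p q)// ?mulr0// -(edge_count_gt0 R).
  by rewrite (edge_count_eq0 npq) mul0r.
have pC : C \in pi_v_mc R v.
  apply/pi_v_mcP; split => //; last first.
    by apply/reachP; exists w2, v; split; [|exact: eqxx|exact: x_conn].
  move=> C' cC' nC rC'C; have [p pC'] := comp_neq0 cC'.
  have pw2 : conn p w2 := reach_compC cC' cC pC' w2C rC'C.
  have w2C' : w2 \notin C'.
    by apply: contraNN nC => w2C'; apply/eqP; exact: comp_eq cC' cC w2C' w2C.
  have [p' [q [p'C' qC' p'q qw2]]] := comp_exit cC' pC' w2C' pw2.
  apply: (harmonic_rho_lt lam_gt0 x_ge0 x_harm cC' _ p'C' qC' p'q).
    move=> z zC'; apply: (harmonic_back lam_gt0 x_ge0 x_harm) xw2.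
    exact: connect_trans (comp_conn cC' zC' pC') pw2.
  exact: (harmonic_back lam_gt0 x_ge0 x_harm) qw2 xw2.
have /andP[_ /eqP] := w2Z; rewrite (y_P C)// normr0 => /esym/eqP.
by rewrite gt_eqF// mulr_gt0.
Qed.

End Decomposition.

(** * The limit of the normalised partition functions *)

Section LimitVector.
Variables (R : realType) (E : digraph) (v : vert E) (b : R).
Hypothesis bE : beta_crit R v = b%:E.
Notation edge_count := (@edge_count R E).

Lemma Zfun_fin_above beta : b < beta -> (Zfun v beta < +oo)%E.
Proof.
move=> bb; have : (beta_crit R v < beta%:E)%E by rewrite bE lte_fin.
move=> /ereal_inf_lt[_ [g Zg <-]]; rewrite lte_fin => gb.
by apply: le_lt_trans Zg; apply: Zfun_anti; exact: ltW.
Qed.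

Lemma Zfun_fin_ge beta : (Zfun v beta < +oo)%E -> b <= beta.
Proof.
by move=> Zb; rewrite -lee_fin -bE; apply: ereal_inf_lbound; exists beta.
Qed.

Variables (C0 : {set vert E}).
Hypotheses (cC0 : C0 \in components E) (vC0 : v \in C0).

(** After rescaling by the largest pole order, numerators and denominator of
Z_{w,v} / Z_v have finite limits, and that of the denominator is positive. *)
Theorem limit_vector : exists x : vert E -> R,
  [/\ forall w, fine (Zfun2 w v z) / fine (Zfun v z) @[z --> b^'+] --> x w,
      (forall w, 0 <= x w) /\ \sum_w x w = 1,
      harmonic (expR b) x, (forall w, 0 < x w -> conn w v)
    & forall C w, C \in components E -> w \in C -> conn w v ->
       (0 < x w <-> exists mu : fpath (Bgraph C0),
          Bpaths C mu /\ maximal_path R v mu)].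
Proof.
have Zfin := Zfun_fin_above.
have [k hk] := Zreal_order Zfin.
have [my hmy] : {my : vert E -> nat * R & forall w, conn w v -> 0 < (my w).2 /\
    scaled b k (my w).1 (Zreal v ^~ w) z @[z --> b^'+] --> (my w).2}.
  apply: (@choice _ _ (fun w (my : nat * R) => conn w v -> 0 < my.2 /\
    scaled b k my.1 (Zreal v ^~ w) z @[z --> b^'+] --> my.2)) => w.
  have [wv|_] := boolP (conn w v); last by exists (0%N, 0).
  by have [m [y [y0 ylim]]] := hk w wv; exists (m, y).
pose m w := (my w).1; pose y w := (my w).2.
have y0 w : conn w v -> 0 < y w by move=> /hmy[].
have ylim w : conn w v -> scaled b k (m w) (Zreal v ^~ w) z @[z --> b^'+] --> y w.
  by move=> /hmy[].
have vv : conn v v := connect0 _ _.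
case: (@arg_minnP _ v (fun w => conn w v) m vv) => ws wsv wsmin.
pose n := m ws; pose Y := order_coef v m y n.
have Y_ge0 w : 0 <= Y w by exact: order_coef_ge0.
have Ylim w : scaled b k n (Zreal v ^~ w) z @[z --> b^'+] --> Y w.
  by apply: scaled_Zreal_cvg => // wv; exact: wsmin.
pose S := \sum_w Y w.
have Yws : 0 < Y ws by rewrite /Y /order_coef wsv eqxx mul1r y0.
have S0 : 0 < S.
  by rewrite /S (bigD1 ws)//= ltr_wpDr//; exact: sumr_ge0.
have Ynconn w : ~~ conn w v -> Y w = 0.
  by move=> /negbTE wv; rewrite /Y /order_coef wv mul0r.
have Ybal w : Y w = ((w == v) && (k == n))%:R + expR (- b) * kernel_app edge_count Y w.
  have [wv|wv] := boolP (conn w v).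
    by apply: (order_coef_balance Zfin) => //; exact: wsmin.
  rewrite Ynconn// (_ : (w == v) = false) ?add0r; last first.
    by apply: contraNF wv => /eqP ->.
  rewrite /kernel_app big1 ?mulr0// => u _; have [wu|nwu] := boolP (0 < edge_count w u).
    rewrite Ynconn ?mulr0//; apply: contraNN wv; apply: connect_trans.
    by apply: connect1; rewrite -(edge_count_gt0 R).
  by rewrite (edge_count_eq0 nwu) mul0r.
have lamt : expR b * expR (- b) = 1 by rewrite -expRD subrr expR0.
have kapY w : kernel_app edge_count Y w = expR b * Y w - expR b * ((w == v) && (k == n))%:R.
  by rewrite [in RHS](Ybal w) mulrDr mulrA lamt mul1r addrAC subrr add0r.
(* If no vertex had a pole, the limits Y would satisfy Y = e_v + t0 A Y and
   yield a finite partition function slightly below the critical temperature. *)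
have kn : k != n.
  apply/negP => /eqP kn.
  have [||||U [th [/andP[th0 thb] U0 Upos Ule]]] :=
      @strict_supersolution R _ edge_count _ Y (expR b) (expR_gt0 b).
  - by move=> *; exact: edge_count_ge0.
  - exact: Y_ge0.
  - by move=> w; rewrite kapY lerBlDr lerDl mulr_ge0 ?expR_ge0 ?ler0n.
  - move=> w Yw; exists v.
      have : conn w v by apply: contraTT Yw => /Ynconn ->; rewrite ltxx.
      rewrite /kernel_connect (@eq_connect _ _ (@arc E))// => p q; exact: edge_count_gt0.
    by rewrite kapY eqxx kn eqxx mulr1 ltrBlDr ltrDl expR_gt0.
  have Yv : 0 < Y v.
    by rewrite Ybal eqxx kn eqxx ltr_wpDr// mulr_ge0 ?expR_ge0// kernel_app_ge0// => *;
      exact: edge_count_ge0.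
  pose g := (th + expR b) / 2.
  have g0 : 0 < g by rewrite /g; have := expR_gt0 b; lra.
  have gE : expR (ln g) = g by rewrite lnK.
  have : (Zfun v (ln g) < +oo)%E.
    apply: (Zfun_fin_supersolution th0 _ U0 (Upos _ Yv) Ule).
    by rewrite gE /g; lra.
  by move=> /Zfun_fin_ge; rewrite -ler_expR gE /g; lra.
have knf : (k == n) = false by exact/negbTE.
exists (fun w => Y w / S); split.
- move=> w; apply: (@right_cvg_ext _ _ (fun z =>
    scaled b k n (Zreal v ^~ w) z / \sum_u scaled b k n (Zreal v ^~ u) z)).
    move=> z bz; rewrite (fine_Zfun (Zfin z bz)) /scaled -mulr_sumr.
    rewrite invfM mulrACA divff ?mul1r// mulf_neq0 ?invr_neq0 ?expf_neq0//.
      by rewrite gt_eqF// weight_gap_gt0.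
    by rewrite gt_eqF// weight_gap_gt0.
  apply: cvgM => //; apply: cvgV; first by rewrite gt_eqF.
  exact: cvg_bigsum.
- split; first by move=> w; rewrite divr_ge0// ltW.
  by rewrite -mulr_suml divff// gt_eqF.
- move=> w; rewrite /kernel_app; under eq_bigr do rewrite mulrA.
  by rewrite -mulr_suml -/(kernel_app edge_count Y w) kapY knf andbF mulr0 subr0 mulrA.
- move=> w; rewrite pmulr_lgt0 ?invr_gt0// => Yw.
  by apply: contraTT Yw => /Ynconn ->; rewrite ltxx.
move=> C w cC wC wv; rewrite pmulr_lgt0 ?invr_gt0//.
rewrite (@maximal_path_order R E v C0 cC0 vC0 b k m _ _ C w cC wC wv); last first.
- exact: component_order Zfin k m y y0 ylim.
- by rewrite bE.
split => [Yw u uv|mmin].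
  suff -> : m w = n by exact: wsmin.
  by apply: contraTeq Yw => /negbTE mn; rewrite /Y /order_coef mn andbF mul0r ltxx.
rewrite /Y /order_coef wv (_ : m w == n) ?mul1r ?y0//.
by rewrite eqn_leq mmin// wsmin.
Qed.

End LimitVector.

(** * Complex differentiability of exp(iz) *)

Section ComplexExponential.
Variable R : realType.
Implicit Types (x y : R) (z h : R[i]).

Lemma normC_le_ReIm (c d : R) : `|c +i* d| <= (`|c| + `|d|)%:C.
Proof.
rewrite (_ : c +i* d = c%:C + 'i * d%:C); last by simpc.
apply: le_trans (ler_normD _ _) _.
rewrite normrM !normc_def /= !expr0n/= !expr1n !addr0 ?add0r sqrtr1.
by rewrite !sqrtr_sqr -!rmorphM -!rmorphD/= mul1r lexx.
Qed.

Lemma Re_le_norm z : (`|complex.Re z|)%:C <= `|z|.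
Proof. exact: normc_ge_Re. Qed.

Lemma Im_le_norm z : (`|complex.Im z|)%:C <= `|z|.
Proof.
have := Re_le_norm ('i * z); case: z => c d /=.
rewrite mul0r mul1r sub0r normrN normrM.
rewrite (_ : `|'i| = 1 :> R[i]) ?mul1r//.
by rewrite normc_def/= expr0n expr1n add0r sqrtr1.
Qed.

(** The first order expansion of f at 0, in multiplicative form. *)
Lemma deriv_bound (f : R -> R) (l : R) : is_derive (0 : R) 1 f l ->
  forall e : R, 0 < e -> \forall x \near (0 : R), `|f x - f 0 - l * x| <= e * `|x|.
Proof.
move=> fl e e0.
have fd : h^-1 *: (f (h *: 1 + 0) - f 0) @[h --> (0:R)^'] --> l.
  have := ex_derive (is_derive := fl); rewrite /derivable => /cvgP/=.
  by rewrite -(derive_val (is_derive := fl)).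
move/cvgrPdist_le : fd => /(_ e e0); rewrite near_withinE => fn.
near=> x; have [->|x0] := eqVneq x 0; first by rewrite subrr mulr0 subr0 !normr0 mulr0.
rewrite -ler_pdivrMr ?normr_gt0// -normf_div.
have -> : (f x - f 0 - l * x) / x = x^-1 *: (f (x *: 1 + 0) - f 0) - l.
  by rewrite /GRing.scale/= mulr1 addr0; field.
by rewrite distrC; apply: (near fn).
Unshelve. all: end_near. Qed.

Lemma nbhs_complex (P : R -> Prop) : (\forall x \near (0 : R), P x) ->
  \forall h \near (0 : R[i]^o), P (complex.Re h) /\ P (complex.Im h).
Proof.
move=> /nbhs_normP[d /= d0 dP]; apply/nbhs_normP; exists d%:C; first by rewrite /= ltcR.
move=> h /=; rewrite sub0r normrN => hd.
split; apply: dP; rewrite /ball_/= sub0r normrN -ltcR; apply: le_lt_trans hd.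
  exact: Re_le_norm.
exact: Im_le_norm.
Qed.

(** exp(iz), written through real functions. *)
Definition expi z : R[i] :=
  (expR (- complex.Im z))%:C * (cos (complex.Re z) +i* sin (complex.Re z)).

Lemma expi_real x : expi x%:C = cos x +i* sin x.
Proof. by rewrite /expi/= oppr0 expR0 mul1r. Qed.

Lemma expi_imag x : expi (0 +i* x) = (expR (- x))%:C.
Proof. by rewrite /expi/= cos0 sin0 mulr1. Qed.

Lemma expiD z h : expi (z + h) = expi z * expi h.
Proof.
case: z h => a c [d e]; rewrite /expi/= opprD expRD rmorphM/= cosD sinD.
by rewrite mulrACA; congr (_ * _); simpc; congr (_ +i* _); rewrite addrC.
Qed.

(** For h = x + i y, the remainder exp(ih) - 1 - ih is a combination of the
remainders e1, e2, e3 of exp(-y), cos x and sin x, each at most g |h| for h small;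
the factor 10 in the choice of g absorbs the constants. *)
Lemma expi_deriv0 :
  (fun h : R[i]^o => h^-1 * (expi h - 1) : R[i]^o) @ (0 : R[i]^o)^' --> ('i : R[i]^o).
Proof.
apply/cvgrPdist_le => /= e e0.
have [d d0 dE] : exists2 d : R, 0 < d & e = d%:C.
  exists (complex.Re e); first by rewrite -ltcR RRe_real// ger0_real// ltW.
  by rewrite RRe_real// ger0_real// ltW.
pose g := Num.min (d / 10) 1.
have g0 : 0 < g by rewrite lt_min divr_gt0//=.
have g1 : g <= 1 by rewrite ge_min lexx orbT.
have gd : g * 10 <= d by rewrite -ler_pdivlMr// ge_min lexx.
have hexp := deriv_bound (is_derive_expR 0) g0.
have hsin := deriv_bound (is_derive_sin 0) g0.
have hcos := deriv_bound (is_derive_cos 0) g0.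
have habs : \forall x \near (0 : R), `|x| <= g by exact: nbhs0_le.
have hexp' : \forall x \near (0 : R),
    `|expR (- x) - expR 0 - expR 0 * (- x)| <= g * `|- x|.
  move/nbhs_normP : hexp => [r /= r0 rP]; apply/nbhs_normP; exists r => //= x.
  by move=> xr; apply: rP; move: xr; rewrite /ball_/= !sub0r opprK normrN.
pose Q x := [/\ `|expR (- x) - expR 0 - expR 0 * (- x)| <= g * `|- x|,
  `|sin x - sin 0 - cos 0 * x| <= g * `|x|,
  `|cos x - cos 0 - - sin 0 * x| <= g * `|x| & `|x| <= g].
have Q0 : \forall x \near (0 : R), Q x.
  by near=> x; split; near: x.
have Hc := nbhs_dnbhs (nbhs_complex Q0).
near=> h.
have h0 : h != 0 by near: h; exact: nbhs_dnbhs_neq.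
have [] : Q (complex.Re h) /\ Q (complex.Im h) by near: h; exact: Hc.
rewrite /Q expR0 sin0 cos0 oppr0 !mul1r !mul0r !addr0 !subr0.
move=> [_ hs hc hx] [he _ _ hy].
have hE : `|'i - h^-1 * (expi h - 1)| = `|h|^-1 * `|expi h - 1 - 'i * h|.
  rewrite -normfV -normrM distrC; congr (`| _ |).
  by rewrite [in RHS]mulrBr [h^-1 * ('i * h)]mulrC mulfK.
rewrite hE ler_pdivrMl ?normr_gt0// dE.
have rh := normC_Re h; set r := complex.Re `|h| in rh.
have hxr : `|complex.Re h| <= r by rewrite -lecR -rh; exact: Re_le_norm.
have hyr : `|complex.Im h| <= r by rewrite -lecR -rh; exact: Im_le_norm.
rewrite rh -rmorphM/=.
set x := complex.Re h in hs hc hx hxr; set y := complex.Im h in he hy hyr.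
have -> : expi h - 1 - 'i * h =
    (expR (- y) * cos x - 1 + y) +i* (expR (- y) * sin x - x).
  rewrite /expi -/x -/y (_ : h = x +i* y); last by rewrite /x /y; case: (h).
  by simpc.
suff key : `|expR (- y) * cos x - 1 + y| + `|expR (- y) * sin x - x| <= r * d.
  rewrite -lecR in key; exact: (le_trans (normC_le_ReIm _ _) key).
rewrite opprK normrN in he.
set e1 := expR (- y) - 1 + y in he.
set e2 := cos x - 1 in hc; set e3 := sin x - x in hs.
have yg : `|y| <= 1 by exact: (le_trans hy g1).
have xg : `|x| <= 1 by exact: (le_trans hx g1).
have r0 : 0 <= r by exact: (le_trans (normr_ge0 _) hxr).
have -> : expR (- y) * cos x - 1 + y = e1 + e2 * (1 - y + e1) by rewrite /e1 /e2; ring.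
have -> : expR (- y) * sin x - x = e3 + (e1 - y) * (x + e3) by rewrite /e1 /e3; ring.
have b1 : `|e1| <= g * r by apply: (le_trans he); rewrite ler_wpM2l// ltW.
have b2 : `|e2| <= g * r by apply: (le_trans hc); rewrite ler_wpM2l// ltW.
have b3 : `|e3| <= g * r by apply: (le_trans hs); rewrite ler_wpM2l// ltW.
have b1' : `|e1| <= g by apply: (le_trans he); rewrite ler_piMr// ltW.
have b3' : `|e3| <= r.
  by apply: (le_trans b3); rewrite ler_piMl.
have c1 : `|1 - y + e1| <= 3.
  apply: (le_trans (ler_normD _ _)); apply: (le_trans (lerD (ler_normB _ _) b1')).
  by rewrite normr1; lra.
have c2 : `|e1 - y| <= g * 2.
  by apply: (le_trans (ler_normB _ _)); lra.
have c3 : `|x + e3| <= r * 2 by apply: (le_trans (ler_normD _ _)); lra.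
apply: (@le_trans _ _ (g * r + g * r * 3 + (g * r + g * 2 * (r * 2)))).
  apply: lerD; apply: (le_trans (ler_normD _ _)); apply: lerD => //.
    by rewrite normrM ler_pM.
  by rewrite normrM ler_pM.
apply: le_trans (ler_wpM2l r0 gd).
have gr : 0 <= g * r by rewrite mulr_ge0// ltW.
have -> : r * (g * 10) = g * r * 10 by ring.
have -> : g * r + g * r * 3 + (g * r + g * 2 * (r * 2)) = g * r * 9 by ring.
by rewrite ler_wpM2l// ler_nat.
Unshelve. all: end_near. Qed.

(** From the derivative at 0 and the addition formula. *)
Lemma expi_scale_derivable (V : normedModType R[i]) (a : V) (z : R[i]) :
  derivable (fun z : R[i]^o => expi z *: a) z 1.
Proof.
have lim : (fun h : R[i]^o => (h^-1 * (expi h - 1) : R[i]^o) *: (expi z *: a))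
    @ (0 : R[i]^o)^' --> ('i : R[i]^o) *: (expi z *: a).
  exact: cvgZr_tmp expi_deriv0.
pose f (z : R[i]^o) := expi z *: a.
have E : (fun h : R[i]^o => h^-1 *: ((f \o shift (z : R[i]^o)) (h *: (1 : R[i]^o)) - f z)) =
    (fun h : R[i]^o => (h^-1 * (expi h - 1) : R[i]^o) *: (expi z *: a)).
  apply/funext => h; have hE : h *: (1 : R[i]^o) = h by rewrite /GRing.scale/= mulr1.
  rewrite /f/= hE expiD.
  by rewrite -scalerBl !scalerA; congr (_ *: _); rewrite -[RHS]mulrA mulrBl mul1r.
rewrite -E in lim; apply/cvg_ex; exists ('i *: (expi z *: a)); exact: lim.
Qed.

End ComplexExponential.

(** * C*-algebras and closed subspaces *)

Section CstarBasics.
Variables (R : realType) (A : cstarAlgebra R).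
Implicit Types a b c : A.

Lemma mul0c a : (0 : A) ** a = 0.
Proof. by apply: (@addrI _ (0 ** a)); rewrite -cs_mulDl !addr0. Qed.

Lemma mulc0 a : a ** (0 : A) = 0.
Proof. by apply: (@addrI _ (a ** 0)); rewrite -cs_mulDr !addr0. Qed.

Lemma mulNc a b : (- a) ** b = - (a ** b).
Proof. by apply/eqP; rewrite -addr_eq0 -cs_mulDl addNr mul0c. Qed.

Lemma mulcN a b : a ** (- b) = - (a ** b).
Proof. by apply/eqP; rewrite -addr_eq0 -cs_mulDr addNr mulc0. Qed.

Lemma mulcBl a b c : (a - b) ** c = a ** c - b ** c.
Proof. by rewrite cs_mulDl mulNc. Qed.

Lemma mulcBr a b c : a ** (b - c) = a ** b - a ** c.
Proof. by rewrite cs_mulDr mulcN. Qed.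

Lemma mulc_suml (I : finType) (P : pred I) (f : I -> A) b :
  (\sum_(i | P i) f i) ** b = \sum_(i | P i) f i ** b.
Proof.
by apply: (big_morph (fun a => a ** b)) => [x y|]; rewrite ?cs_mulDl ?mul0c.
Qed.

Lemma mulc_sumr (I : finType) (P : pred I) (f : I -> A) b :
  b ** (\sum_(i | P i) f i) = \sum_(i | P i) b ** f i.
Proof.
by apply: (big_morph (fun a => b ** a)) => [x y|]; rewrite ?cs_mulDr ?mulc0.
Qed.

Lemma star0 : (0 : A)^#* = 0.
Proof. by apply: (@addrI _ ((0 : A)^#*)); rewrite -cs_starD !addr0. Qed.

Lemma starN a : (- a)^#* = - a^#*.
Proof. by apply/eqP; rewrite -addr_eq0 -cs_starD addNr star0. Qed.

Lemma starB a b : (a - b)^#* = a^#* - b^#*.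
Proof. by rewrite cs_starD starN. Qed.

Lemma star_sum (I : finType) (P : pred I) (f : I -> A) :
  (\sum_(i | P i) f i)^#* = \sum_(i | P i) (f i)^#*.
Proof. by apply: (big_morph (@cs_star R A)); [exact: cs_starD|exact: star0]. Qed.

Lemma cstar_eq0 a : a^#* ** a = 0 -> a = 0.
Proof.
move=> aa; apply/eqP; rewrite -normr_eq0 -sqrf_eq0 -cs_normE aa normr0.
by [].
Qed.

Lemma norm_star_le a : `|a| <= `|a^#*|.
Proof.
have [->|a0] := eqVneq a 0; first by rewrite normr0.
have an : 0 < `|a| by rewrite normr_gt0.
have := cs_normM a^#* a; rewrite cs_normE expr2.
by rewrite ler_pM2r.
Qed.

Lemma norm_star a : `|a^#*| = `|a|.
Proof.
apply/eqP; rewrite eq_le norm_star_le andbT.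
by have := norm_star_le a^#*; rewrite cs_starK.
Qed.

Definition closed_subspace (V : set A) : Prop :=
  [/\ closed V, V 0 & forall (k : R[i]) a b, V a -> V b -> V (k *: a + b)].

Lemma closed_preimage_bounded (V : set A) (f : A -> A) (K : R[i]) : 0 < K ->
  (forall a b, `|f a - f b| <= K * `|a - b|) -> closed V ->
  closed [set a | V (f a)].
Proof.
move=> K0 fK clV a acl; apply: clV => B /nbhs_ballP[e /= e0 eB].
have [c [Vc]] : [set a | V (f a)] `&` ball a (e / K) !=set0.
  by apply: acl; apply: nbhsx_ballx; rewrite divr_gt0.
rewrite -ball_normE/= => ac; exists (f c); split => //; apply: eB.
rewrite -ball_normE/=; have := fK a c => /le_lt_trans; apply.
by rewrite mulrC -ltr_pdivlMr.
Qed.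

Lemma closed_mull (V : set A) a : closed V -> closed [set c | V (a ** c)].
Proof.
apply: (@closed_preimage_bounded _ _ (`|a| + 1)) => [|x y].
  by rewrite ltr_wpDl.
rewrite -mulcBr; apply: (le_trans (cs_normM _ _)).
by rewrite ler_wpM2r// lerDl.
Qed.

Lemma closed_mulr (V : set A) a : closed V -> closed [set c | V (c ** a)].
Proof.
apply: (@closed_preimage_bounded _ _ (`|a| + 1)) => [|x y].
  by rewrite ltr_wpDl.
rewrite -mulcBl; apply: (le_trans (cs_normM _ _)).
by rewrite mulrC ler_wpM2r// lerDl.
Qed.

Lemma closed_star (V : set A) : closed V -> closed [set c | V c^#*].
Proof.
apply: (@closed_preimage_bounded _ _ 1) => // x y.
by rewrite -starB norm_star mul1r.
Qed.

(** The closed linear span, as the intersection of all closed subspaces containing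
M; this avoids handling approximations by linear combinations. *)
Definition cspan (M : set A) : set A :=
  [set a | forall V, closed_subspace V -> M `<=` V -> V a].

Lemma cspan_sub M : M `<=` cspan M.
Proof. by move=> a Ma V _; apply. Qed.

Lemma cspan_min M V : closed_subspace V -> M `<=` V -> cspan M `<=` V.
Proof. by move=> sV MV a; apply. Qed.

Lemma cspan_subspace M : closed_subspace (cspan M).
Proof.
split=> [a acl V sV MV|V [_ V0 _] _ //|k a b Ma Mb V sV MV].
  have [clV _ _] := sV; apply: clV => B aB.
  by have [c [Mc Bc]] := acl B aB; exists c; split => //; exact: Mc.
by have [_ _ lV] := sV; apply: lV; [exact: Ma|exact: Mb].
Qed.

Lemma closed_subspace_mull V a : closed_subspace V -> closed_subspace [set c | V (a ** c)].
Proof.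
move=> [clV V0 lV]; split; [exact: closed_mull| by rewrite /= mulc0|].
by move=> k c d /= Vc Vd; rewrite cs_mulDr cs_mulZr; exact: lV.
Qed.

Lemma closed_bigI (I : Type) (F : I -> set A) :
  (forall i, closed (F i)) -> closed [set a | forall i, F i a].
Proof.
move=> clF a acl i; apply: (clF i) => B aB.
by have [c [Fc Bc]] := acl B aB; exists c.
Qed.

(** The elements that lie, with their adjoints, in the closed span and multiply M
into it on the left form a closed star-subalgebra; so it is enough to check the
generators. *)
Lemma generated_cspan (X M : set A) : cstar_generated X ->
  (forall a, X a -> cspan M a /\ cspan M a^#*) ->
  (forall a m, X a -> M m -> cspan M (a ** m) /\ cspan M (a^#* ** m)) ->
  cspan M = setT.
Proof.
move=> gX XM XMM; have [clM M0 lM] := cspan_subspace M.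
pose S := [set a | (cspan M a /\ cspan M a^#*) /\
  forall m : {m : A | M m}, cspan M (a ** sval m) /\ cspan M (a^#* ** sval m)].
have mulM a c : (forall m : {m : A | M m}, cspan M (a ** sval m)) ->
    cspan M c -> cspan M (a ** c).
  move=> aM; apply: (@cspan_min M [set c | cspan M (a ** c)]).
    exact: closed_subspace_mull (cspan_subspace M).
  by move=> m Mm; exact: (aM (exist _ m Mm)).
suff : S = setT.
  move=> ST; apply/seteqP; split => // a _.
  have : S a by rewrite ST.
  by case=> [[]].
apply: gX.
- move=> a Xa; split; first exact: XM.
  by move=> [m Mm]; exact: XMM.
- apply: closedI.
    by apply: closedI => //; exact: closed_star.
  apply: closed_bigI => -[m Mm]; apply: closedI; first exact: closed_mulr.
  apply: (@closed_star [set c | cspan M (c ** m)]); exact: closed_mulr.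
- split; first by rewrite star0.
  by move=> m; rewrite star0 mul0c.
- move=> k a b [[aM asM] aMM] [[bM bsM] bMM]; split.
    by split; [exact: lM|rewrite cs_starD cs_starZ; exact: lM].
  move=> m; rewrite cs_starD cs_starZ !cs_mulDl !cs_mulZl.
  by split; apply: lM; [exact: (aMM m).1|exact: (bMM m).1|exact: (aMM m).2|exact: (bMM m).2].
- move=> a b [[aM asM] aMM] [[bM bsM] bMM]; split.
    split; first by apply: mulM => // m; exact: (aMM m).1.
    by rewrite cs_starM; apply: mulM => // m; exact: (bMM m).2.
  move=> m; rewrite cs_starM -!cs_mulA; split.
    by apply: mulM; [move=> m'; exact: (aMM m').1|exact: (bMM m).1].
  by apply: mulM; [move=> m'; exact: (bMM m').2|exact: (aMM m).2].
- move=> a [[aM asM] aMM]; rewrite /S/= cs_starK; split => // m.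
  by split; [exact: (aMM m).2|exact: (aMM m).1].
Qed.

(** The degenerate case of the Cauchy-Schwarz inequality: in
phi((c^* + k x)^* (c^* + k x)) >= 0 the term quadratic in k vanishes, and a
function affine in real k, or in imaginary k, is bounded below only if its slope
is 0. *)
Lemma positive_cauchy_schwarz (phi : A -> R[i]) x : scalar phi ->
  (forall a, 0 <= phi (a^#* ** a)) -> phi (x^#* ** x) = 0 ->
  forall c, phi (c ** x) = 0.
Proof.
move=> phil pos xx c.
have phiD a b : phi (a + b) = phi a + phi b.
  by have := phil 1 a b; rewrite scale1r mul1r.
have phiZ (k : R[i]) a : phi (k *: a) = k * phi a.
  have phi0 : phi 0 = 0 by apply: (@addrI _ (phi 0)); rewrite -phiD !addr0.
  by have := phil k a 0; rewrite !addr0 phi0 addr0.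
set al := phi (c ** x); set be := phi (x^#* ** c^#*); set K := phi (c ** c^#*).
have key (k : R[i]) : 0 <= K + k * al + k^* * be.
  have := pos (c^#* + k *: x); rewrite cs_starD cs_starK cs_starZ.
  rewrite cs_mulDl !cs_mulDr !phiD !cs_mulZr !cs_mulZl !phiZ xx.
  by rewrite !mulr0 addr0.
have lin (g : R[i]) : (forall r : R, 0 <= K + r%:C * g) -> g = 0.
  case: g K {key} => [gr gi] [kr ki] h.
  have h' (r : R) : (ki + r * gi == 0) && (0 <= kr + r * gr).
    by have := h r; rewrite lecE/= !mul0r subr0 addr0.
  have ki0 : ki = 0 by have /andP[/eqP] := h' 0; rewrite mul0r addr0.
  have gi0 : gi = 0 by have /andP[/eqP] := h' 1; rewrite mul1r ki0 add0r.
  suff -> : gr = 0 by rewrite gi0.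
  apply/eqP/negPn/negP => g0.
  have /andP[_] := h' (- (kr + 1) / gr).
  by rewrite divfK// opprD addNKr; lra.
have e1 : al + be = 0.
  apply: lin => r; have cr : conjc r%:C = r%:C by exact: conjc_real.
  have E : K + r%:C * (al + be) = K + r%:C * al + conjc r%:C * be.
    by rewrite cr mulrDr addrA.
  by rewrite E; exact: key.
have e2 : 'i * (al - be) = 0.
  apply: lin => r; have cr : conjc (r%:C * 'i) = - (r%:C * 'i).
    by simpc.
  have E : K + r%:C * ('i * (al - be)) =
      K + (r%:C * 'i) * al + conjc (r%:C * 'i) * be.
    by rewrite cr; ring.
  by rewrite E; exact: key.
move/eqP: e2; rewrite mulf_eq0 => /orP[/eqP[]/eqP|]; first by rewrite oner_eq0.
rewrite subr_eq0 => /eqP e2; move/eqP: e1; rewrite -e2 -mulr2n -mulr_natl mulf_eq0.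
by rewrite pnatr_eq0 /= => /eqP.
Qed.

End CstarBasics.

(** * KMS states on the Toeplitz algebra *)

Section ToeplitzKMS.
Variables (R : realType) (E : digraph) (A : cstarAlgebra R).
Variables (p : vert E -> A) (s : edge E -> A) (alpha : R -> A -> A).
Hypothesis fam : toeplitz_family p s.
Hypothesis halpha : is_gauge_action p s alpha.
Implicit Types (a c d m : A) (u w : vert E) (e f : edge E).

Lemma p_star u : (p u)^#* = p u. Proof. by case: fam => /(_ u)[]. Qed.
Lemma p_idem u : p u ** p u = p u. Proof. by case: fam => /(_ u)[]. Qed.
Lemma p_orth u w : u != w -> p u ** p w = 0.
Proof. by case: fam => _ h _ _ _; exact: h. Qed.
Lemma s_isom e : (s e)^#* ** s e = p (rng e).
Proof. by case: fam => _ _ h _ _; exact: h. Qed.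

Lemma s_rng e : s e ** p (rng e) = s e.
Proof.
apply/esym/eqP; rewrite -subr_eq0; apply/eqP; apply: cstar_eq0.
rewrite starB cs_starM p_star mulcBl !mulcBr.
rewrite -!cs_mulA [(s e)^#* ** (s e ** _)]cs_mulA s_isom !p_idem.
by rewrite !subrr.
Qed.

Lemma star_s_rng e : p (rng e) ** (s e)^#* = (s e)^#*.
Proof. by rewrite -[in RHS](s_rng e) cs_starM p_star. Qed.

Lemma s_orth e f : e != f -> (s e)^#* ** s f = 0.
Proof.
move=> ef; have [_ _ _ /(_ e f ef) h _] := fam.
rewrite -(star_s_rng e) -(s_rng f) -!s_isom.
transitivity ((s e)^#* ** ((s e ** (s e)^#*) ** (s f ** (s f)^#*)) ** s f).
  by rewrite -!cs_mulA.
by rewrite h mulc0 mul0c.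
Qed.

Section KMS.
Variables (beta : R) (phi : A -> R[i]).
Hypothesis kms : is_KMS_state alpha beta phi.

Lemma kms_linear : scalar phi. Proof. by case: kms => -[]. Qed.
Lemma kms_pos a : 0 <= phi (a^#* ** a).
Proof. by case: kms => -[_ h _] _; exact: h. Qed.

Lemma kmsD a c : phi (a + c) = phi a + phi c.
Proof. by have := kms_linear 1 a c; rewrite scale1r mul1r. Qed.

Lemma kms0 : phi 0 = 0.
Proof. by apply: (@addrI _ (phi 0)); rewrite -kmsD !addr0. Qed.

Lemma kmsZ (k : R[i]) a : phi (k *: a) = k * phi a.
Proof. by have := kms_linear k a 0; rewrite !addr0 kms0 addr0. Qed.

Lemma kmsN a : phi (- a) = - phi a.
Proof. by apply/eqP; rewrite -addr_eq0 -kmsD addNr kms0. Qed.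

Lemma kmsB a c : phi (a - c) = phi a - phi c.
Proof. by rewrite kmsD kmsN. Qed.

Lemma kms_s e c : phi (s e ** c) = (expR (- beta))%:C * phi (c ** s e).
Proof.
have ent : entire_orbit alpha (s e) (fun z => expi z *: s e).
  split => [t|z]; last exact: expi_scale_derivable.
  by case: halpha => _ _ _ _ ->; rewrite expi_real.
have := kms.2 (s e) c _ ent.
by rewrite expi_imag cs_mulZr kmsZ.
Qed.

Lemma kms_p u c : phi (p u ** c) = phi (c ** p u).
Proof.
have ent : entire_orbit alpha (p u) (fun z => p u).
  split => [t|z]; last exact: derivable_cst.
  by case: halpha => _ _ _ ->.
exact: kms.2 (p u) c _ ent.
Qed.

(** Polarisation: phi(x^* x) is real for x = a + c and for x = a + i c. *)
Lemma kms_herm a c : phi (a^#* ** c) = conjc (phi (c^#* ** a)).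
Proof.
set x := phi (a^#* ** c); set y := phi (c^#* ** a).
have pa := kms_pos a; have pc := kms_pos c.
have h1 : 0 <= phi (a^#* ** a) + x + (y + phi (c^#* ** c)).
  have := kms_pos (a + c); rewrite cs_starD cs_mulDl !cs_mulDr !kmsD; exact.
have h2 : 0 <= phi (a^#* ** a) + 'i * x +
    (conjc 'i * y + 'i * (conjc 'i * phi (c^#* ** c))).
  have := kms_pos (a + 'i *: c).
  rewrite cs_starD cs_starZ cs_mulDl !cs_mulDr !kmsD !cs_mulZr !cs_mulZl !kmsZ.
  exact.
move: pa pc h1 h2; move: (phi (a^#* ** a)) (phi (c^#* ** c)) x y.
move=> [a1 a2] [c1 c2] [x1 x2] [y1 y2].
rewrite !lecE/= => /andP[/eqP -> _] /andP[/eqP -> _] /andP[/eqP h1 _] /andP[/eqP h2 _].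
by congr (_ +i* _); lra.
Qed.

(** The adjoint of the relation for s_e, read through [kms_herm]. *)
Lemma kms_star_s e c : phi ((s e)^#* ** c) = (expR beta)%:C * phi (c ** (s e)^#*).
Proof.
have -> : phi (c ** (s e)^#*) = conjc ((expR (- beta))%:C * phi (c^#* ** s e)).
  by rewrite -{1}[c]cs_starK kms_herm cs_starK kms_s.
have cE (k : R) (z : R[i]) : conjc (k%:C * z) = k%:C * conjc z.
  by case: z => z1 z2; simpc.
rewrite cE kms_herm mulrA.
have -> : (expR beta)%:C * (expR (- beta))%:C = 1 :> R[i].
  by rewrite -rmorphM/= -expRD subrr expR0.
by rewrite mul1r.
Qed.

End KMS.

(** The elements that no KMS state can see, under left multiplication by anything;
[phi d = 0] is required separately because the algebra is not assumed unital. *)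
Definition kms_null : set A := [set d | forall beta phi, 0 < beta ->
  is_KMS_state alpha beta phi -> phi d = 0 /\ forall c, phi (c ** d) = 0].

Lemma kms_null0 : kms_null 0.
Proof. by move=> beta phi b0 K; split=> [|c]; rewrite ?mulc0 (kms0 K). Qed.

Lemma kms_nullN d : kms_null d -> kms_null (- d).
Proof.
move=> Jd beta phi b0 K; have [d0 cd] := Jd _ _ b0 K.
by split=> [|c]; rewrite ?mulcN (kmsN K) ?d0 ?cd oppr0.
Qed.

Lemma kms_null_mull c d : kms_null d -> kms_null (c ** d).
Proof.
move=> Jd beta phi b0 K; have [d0 cd] := Jd _ _ b0 K.
by split=> [|c']; rewrite ?cs_mulA cd.
Qed.

(** phi(c d x) = k phi(x c d) = 0: the KMS condition turns a right factor into a
left one. *)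
Lemma kms_null_mulr_commute d x : (forall beta phi, 0 < beta ->
    is_KMS_state alpha beta phi ->
    exists k, forall c, phi (c ** x) = k * phi (x ** c)) ->
  kms_null d -> kms_null (d ** x).
Proof.
move=> hx Jd beta phi b0 K; have [d0 cd] := Jd _ _ b0 K.
have [k hk] := hx _ _ b0 K.
by split=> [|c]; rewrite ?cs_mulA hk ?cs_mulA cd mulr0.
Qed.

Lemma kms_null_mul_p d u : kms_null d -> kms_null (d ** p u).
Proof.
apply: kms_null_mulr_commute => beta phi b0 K; exists 1 => c.
by rewrite (kms_p K) mul1r.
Qed.

Lemma kms_null_mul_s d e : kms_null d -> kms_null (d ** s e).
Proof.
apply: kms_null_mulr_commute => beta phi b0 K; exists (expR beta)%:C => c.
by rewrite (kms_s K) mulrA -rmorphM/= -expRD subrr expR0 mul1r.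
Qed.

Lemma kms_null_mul_star_s d e : kms_null d -> kms_null (d ** (s e)^#*).
Proof.
apply: kms_null_mulr_commute => beta phi b0 K; exists (expR (- beta))%:C => c.
by rewrite (kms_star_s K) mulrA -rmorphM/= -expRD addNr expR0 mul1r.
Qed.

(** That this vanishes in the algebra follows from q <= p_v, with q the sum of the
s_f s_f^*, by the theory of positive elements; that it is killed by KMS states is
elementary. *)
Definition src_defect e : A := s e - p (src e) ** s e.

Definition range_proj v : A := \sum_(e | src e == v) s e ** (s e)^#*.

Lemma range_proj_star v : (range_proj v)^#* = range_proj v.
Proof.
by rewrite star_sum; apply: eq_bigr => e _; rewrite cs_starM cs_starK.
Qed.

Lemma star_s_range_proj e : (s e)^#* ** range_proj (src e) = (s e)^#*.
Proof.
rewrite mulc_sumr (bigD1 e)//= cs_mulA s_isom star_s_rng big1 ?addr0// => f /andP[_ fe].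
by rewrite cs_mulA s_orth ?mul0c// eq_sym.
Qed.

Lemma range_proj_idem v : range_proj v ** range_proj v = range_proj v.
Proof.
rewrite {1}/range_proj mulc_suml; apply: eq_bigr => e /eqP <-.
by rewrite -cs_mulA star_s_range_proj.
Qed.

(** Write p_v - q = c^* c, x = q - q p_v and y = c - c p_v.  Then
y^* y = - x^* x, so a positive functional vanishes on x^* x; and the adjoint of the
defect is s_e^* x. *)
Lemma star_src_defect_null e : kms_null (src_defect e)^#*.
Proof.
set v := src e; set q := range_proj v.
have dE : (src_defect e)^#* = (s e)^#* ** (q - q ** p v).
  rewrite mulcBr cs_mulA star_s_range_proj.
  by rewrite starB cs_starM p_star.
have [c cE] : cs_le q (p v) by case: fam => _ _ _ _; exact.
have sq : q^#* = q := range_proj_star v.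
have qq : q ** q = q := range_proj_idem v.
pose x := q - q ** p v; pose y := c - c ** p v.
have xE : x^#* ** x = q - q ** p v - (p v ** q - p v ** (q ** p v)).
  rewrite /x starB cs_starM p_star sq mulcBl !mulcBr.
  by rewrite -!cs_mulA ![q ** (q ** _)]cs_mulA !qq.
have yE : y^#* ** y = - (x^#* ** x).
  have subBB (P q' a' : A) : P - q' - (P - a') = a' - q'.
    by rewrite opprB addrC addrA subrK.
  have hp : c^#* ** (c ** p v) = p v - q ** p v.
    by rewrite cs_mulA -cE mulcBl p_idem.
  rewrite xE /y starB cs_starM p_star mulcBl !mulcBr -!cs_mulA hp -cE !mulcBr p_idem.
  by rewrite !subBB [in LHS]opprB [RHS]opprB [in RHS]opprB [RHS]addrC.
have null phi' beta' : is_KMS_state alpha beta' phi' -> phi' (x^#* ** x) = 0.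
  move=> K; apply/le_anti; rewrite (kms_pos K) andbT.
  by have := kms_pos K y; rewrite yE (kmsN K) oppr_ge0.
move=> beta phi b0 K.
have CS := positive_cauchy_schwarz (kms_linear K) (kms_pos K) (null _ _ K).
by rewrite dE -/x; split=> [|c']; rewrite ?cs_mulA CS.
Qed.

(** d = src_defect e satisfies the same KMS relation as s_e, so
phi takes on d^* d a multiple of its value on the product of d with its adjoint,
and the latter is 0 since the adjoint of d is killed by KMS states. *)
Lemma src_defect_null e : kms_null (src_defect e).
Proof.
move=> beta phi b0 K; set d := src_defect e.
have dK c : phi (d ** c) = (expR (- beta))%:C * phi (c ** d).
  rewrite mulcBl mulcBr !(kmsB K) -cs_mulA (kms_p K) -cs_mulA !(kms_s K).
  by rewrite mulrBr cs_mulA.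
have dd : phi (d^#* ** d) = 0.
  have [_ h] := star_src_defect_null e b0 K.
  have := dK (d^#*); rewrite h => /esym/eqP; rewrite mulf_eq0 => /orP[|/eqP//].
  by rewrite -[0]/(0%:C) (inj_eq (@complexI _)) gt_eqF// expR_gt0.
have CS := positive_cauchy_schwarz (kms_linear K) (kms_pos K) dd.
split => //.
have -> : d = d ** p (rng e) by rewrite mulcBl -cs_mulA s_rng.
by rewrite dK CS mulr0.
Qed.

Inductive monomial : A -> Prop :=
| Mon_p u : monomial (p u)
| Mon_s e m : monomial m -> monomial (s e ** m)
| Mon_star e m : monomial m -> monomial (m ** (s e)^#*).

Lemma kms_null_mul_monomial d m : kms_null d -> monomial m -> kms_null (d ** m).
Proof.
move=> Jd mm; elim: mm d Jd => [u d|e m' _ IH d|e m' _ IH d] Jd.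
- exact: kms_null_mul_p.
- by rewrite cs_mulA; apply: IH; exact: kms_null_mul_s.
- by rewrite cs_mulA; apply: kms_null_mul_star_s; exact: IH.
Qed.

(** A monomial begins with p_w or with some s_e, and p_u s_e is s_e or 0 up to the
source defect of e. *)
Lemma p_monomial u m : monomial m ->
  kms_null (p u ** m - m) \/ kms_null (p u ** m).
Proof.
elim=> [w|e m' mm' _|e m' _ [IH|IH]].
- have [->|uw] := eqVneq u w.
    by left; rewrite p_idem subrr; exact: kms_null0.
  by right; rewrite p_orth//; exact: kms_null0.
- have [<-|ue] := eqVneq (src e) u.
    left; rewrite (_ : _ - _ = - (src_defect e ** m')); last first.
      by rewrite mulcBl opprB cs_mulA.
    by apply: kms_nullN; apply: kms_null_mul_monomial mm'; exact: src_defect_null.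
  right; rewrite (_ : _ ** _ = p u ** (src_defect e ** m')).
    apply: kms_null_mull; apply: kms_null_mul_monomial mm'.
    exact: src_defect_null.
  rewrite mulcBl mulcBr -[in X in _ - X]cs_mulA [in X in _ - X]cs_mulA.
  by rewrite p_orth 1?eq_sym// mul0c subr0.
- by left; rewrite cs_mulA -mulcBl; exact: kms_null_mul_star_s.
- by right; rewrite cs_mulA; exact: kms_null_mul_star_s.
Qed.

Lemma star_s_monomial e m : monomial m ->
  exists2 m', monomial m' \/ m' = 0 & kms_null ((s e)^#* ** m - m').
Proof.
elim=> [u|f m' mm' _|f m' _ [m0 Hm0 Jm0]].
- have Jd := star_src_defect_null e.
  have dE : (src_defect e)^#* = (s e)^#* - (s e)^#* ** p (src e).
    by rewrite starB cs_starM p_star.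
  have [<-|ue] := eqVneq (src e) u.
    exists (s e)^#*.
      left; rewrite -star_s_rng; apply: Mon_star; exact: Mon_p.
    by rewrite -opprB -dE; exact: kms_nullN.
  exists 0; first by right.
  rewrite subr0 (_ : _ ** _ = (src_defect e)^#* ** p u); first exact: kms_null_mul_p.
  by rewrite dE mulcBl -cs_mulA p_orth// mulc0 subr0.
- rewrite cs_mulA; have [<-|ef] := eqVneq e f; last first.
    exists 0; first by right.
    by rewrite s_orth// mul0c subrr; exact: kms_null0.
  rewrite s_isom; have [Jm|Jm] := p_monomial (rng e) mm'.
    by exists m' => //; left.
  by exists 0; [right|rewrite subr0].
- exists (m0 ** (s f)^#*).
    by case: Hm0 => [Mm|->]; [left; exact: Mon_star|right; rewrite mul0c].
  by rewrite cs_mulA -mulcBl; exact: kms_null_mul_star_s.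
Qed.

(** Modulo [kms_null] the generators and their adjoints map monomials to monomials
or to 0. *)
Lemma cspan_monomial : cstar_generated (range p `|` range s) ->
  cspan (monomial `|` kms_null) = setT.
Proof.
move=> gen; set M := monomial `|` kms_null.
have [_ c0 cl] := cspan_subspace M.
have cM m : monomial m -> cspan M m by move=> mm; apply: cspan_sub; left.
have cJ d : kms_null d -> cspan M d by move=> Jd; apply: cspan_sub; right.
have cMJ a m : monomial m \/ m = 0 -> kms_null (a - m) -> cspan M a.
  move=> mm Jd; rewrite -(subrK m a) -[a - m]scale1r; apply: cl; first exact: cJ.
  by case: mm => [/cM//|->].
have cp u m : M m -> cspan M (p u ** m).
  move=> [mm|Jm]; last by apply: cJ; exact: kms_null_mull.
  have [J1|J1] := p_monomial u mm; last exact: cJ.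
  by apply: cMJ J1; left.
have cs e m : M m -> cspan M (s e ** m).
  move=> [mm|Jm]; last by apply: cJ; exact: kms_null_mull.
  by apply: cM; exact: Mon_s.
have css e m : M m -> cspan M ((s e)^#* ** m).
  move=> [mm|Jm]; last by apply: cJ; exact: kms_null_mull.
  by have [m' Hm' Jm'] := star_s_monomial e mm; exact: cMJ Jm'.
apply: (generated_cspan gen) => [a [[u _ <-]|[e _ <-]]|a m [[u _ <-]|[e _ <-]] Mm].
- by rewrite p_star; split; apply: cM; exact: Mon_p.
- split; first by rewrite -s_rng; apply: cM; apply: Mon_s; exact: Mon_p.
  by rewrite -star_s_rng; apply: cM; apply: Mon_star; exact: Mon_p.
- by rewrite p_star; split; exact: cp.
- by split; [exact: cs|exact: css].
Qed.

Definition lmul (mu : seq (edge E)) (a : A) : A := foldr (fun e x => s e ** x) a mu.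

(** s_mu s_nu^* cut down by p_u; taking the adjoint of a left product makes the
first edge of nu the last factor. *)
Definition word mu nu u : A := lmul mu (lmul nu (p u))^#*.

Lemma lmul_mulr mu a c : lmul mu a ** c = lmul mu (a ** c).
Proof. by elim: mu => //= e mu <-; rewrite cs_mulA. Qed.

Lemma monomial_word m : monomial m -> exists mu nu u, m = word mu nu u.
Proof.
elim=> [u|e m' _ [mu [nu [u ->]]]|e m' _ [mu [nu [u ->]]]].
- by exists [::], [::], u; rewrite /word/= p_star.
- by exists (e :: mu), nu, u.
- by exists mu, (e :: nu), u; rewrite lmul_mulr /word/= cs_starM.
Qed.

Lemma word_monomial mu nu u : monomial (word mu nu u).
Proof.
rewrite /word; elim: mu => [|e mu IH] /=; last exact: Mon_s.
elim: nu => [|e nu IH] /=; first by rewrite p_star; exact: Mon_p.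
by rewrite cs_starM; exact: Mon_star.
Qed.

(** An element of positive degree n is multiplied by exp (- beta n) <> 1 when it is
moved around the product with p_u. *)
Lemma kms_lmul_zero beta phi mu u : 0 < beta -> is_KMS_state alpha beta phi ->
  mu != [::] -> phi (lmul mu (p u)) = 0.
Proof.
move=> b0 K mu0; set m := lmul mu (p u).
have homog nu c : phi (lmul nu (p u) ** c) =
    (expR (- beta * (size nu)%:R))%:C * phi (c ** lmul nu (p u)).
  elim: nu c => [|e nu IH] c /=; first by rewrite mulr0 expR0 mul1r (kms_p K).
  rewrite -cs_mulA (kms_s K) -cs_mulA IH mulrA -rmorphM/= -expRD cs_mulA.
  by rewrite -natr1 mulrDr mulr1 addrC.
have mm : monomial m.
  by have := word_monomial mu [::] u; rewrite /word/= p_star.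
have mp : m ** p u = m by rewrite lmul_mulr p_idem.
have e1 : phi m = (expR (- beta * (size mu)%:R))%:C * phi (p u ** m).
  by rewrite -homog mp.
have [J1|J1] := p_monomial u mm; last first.
  by rewrite e1 (J1 _ _ b0 K).1 mulr0.
have e2 : phi (p u ** m) = phi m.
  by apply/eqP; rewrite -subr_eq0 -(kmsB K) (J1 _ _ b0 K).1.
rewrite e2 in e1; apply/eqP; move/eqP: e1; rewrite -subr_eq0.
rewrite -{1}[phi m]mul1r -mulrBl mulf_eq0 => /orP[|//].
rewrite -[1]/(1%:C) -rmorphB -[0]/(0%:C) (inj_eq (@complexI _)) subr_eq0 eq_sym.
rewrite lt_eqF// expR_lt1 mulNr oppr_lt0 mulr_gt0// ltr0n.
by case: (mu) mu0.
Qed.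

(** The value of a KMS state on a word depends on the state only through one of the
values phi(p_w), and in a way that does not depend on the state: remove first edges
of mu and nu two by two with the KMS condition; if mu or nu is exhausted before the
other, the value is 0 by [kms_lmul_zero]. *)
Lemma word_value mu nu u : exists o : option (nat * vert E),
  forall beta phi, 0 < beta -> is_KMS_state alpha beta phi ->
    phi (word mu nu u) =
    if o is Some (n, w) then (expR (- beta * n%:R))%:C * phi (p w) else 0.
Proof.
elim: mu nu => [|e mu IH] [|f nu].
- exists (Some (0%N, u)) => beta phi b0 K.
  by rewrite /word/= p_star mulr0 expR0 mul1r.
- exists None => beta phi b0 K; rewrite /word /=.
  have pm : (s f ** lmul nu (p u))^#* = (p u)^#* ** (s f ** lmul nu (p u))^#*.
    by rewrite -cs_starM -[in RHS]cs_mulA lmul_mulr p_idem.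
  rewrite pm (kms_herm K) cs_starK -[s f ** _]/(lmul (f :: nu) (p u)).
  by rewrite lmul_mulr p_idem (kms_lmul_zero _ b0 K)// conjc0.
- exists None => beta phi b0 K.
  by rewrite /word/= p_star; exact: (kms_lmul_zero (mu := e :: mu) u b0 K).
have wE : word (e :: mu) (f :: nu) u = s e ** (word mu nu u ** (s f)^#*).
  by rewrite /word/= cs_starM lmul_mulr.
have [ef|ef] := eqVneq f e; last first.
  exists None => beta phi b0 K.
  by rewrite wE (kms_s K) -cs_mulA s_orth// mulc0 (kms0 K) mulr0.
have step beta phi : is_KMS_state alpha beta phi ->
    phi (word (e :: mu) (f :: nu) u) =
    (expR (- beta))%:C * phi (p (rng e) ** word mu nu u).
  by move=> K; rewrite wE ef (kms_s K) -cs_mulA s_isom (kms_p K).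
have [J1|J1] := p_monomial (rng e) (word_monomial mu nu u); last first.
  by exists None => beta phi b0 K; rewrite (step _ _ K) (J1 _ _ b0 K).1 mulr0.
have [[[n w]|] ho] := IH nu; last first.
  exists None => beta phi b0 K; rewrite (step _ _ K).
  have := (J1 _ _ b0 K).1; rewrite (kmsB K) => /eqP; rewrite subr_eq0 => /eqP ->.
  by rewrite (ho _ _ b0 K) mulr0.
exists (Some (n.+1, w)) => beta phi b0 K; rewrite (step _ _ K).
have := (J1 _ _ b0 K).1; rewrite (kmsB K) => /eqP; rewrite subr_eq0 => /eqP ->.
rewrite (ho _ _ b0 K) mulrA -rmorphM/= -expRD.
by rewrite -natr1 mulrDr mulr1 addrC.
Qed.

Lemma kms_state_norm beta phi a : is_KMS_state alpha beta phi -> `|phi a| <= `|a|.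
Proof. by case=> -[_ _ []]. Qed.

Lemma kms_gap beta phi v : is_KMS_state alpha beta phi ->
  phi (gap p s v) = phi (p v) - (expR (- beta))%:C * \sum_(e | src e == v) phi (p (rng e)).
Proof.
move=> K; rewrite /gap (kmsB K); congr (_ - _); rewrite mulr_sumr.
rewrite (big_morph phi (kmsD K) (kms0 K)); apply: eq_bigr => e _.
by rewrite (kms_s K) s_isom.
Qed.

(** The sum of the vertex projections, on which the limit functional attains its
norm. *)
Definition unit_proj : A := \sum_u p u.

Lemma norm_unit_proj : `|unit_proj| <= 1.
Proof.
have PP : unit_proj^#* ** unit_proj = unit_proj.
  rewrite star_sum mulc_suml; apply: eq_bigr => u _.
  rewrite p_star mulc_sumr (bigD1 u)//= p_idem big1 ?addr0// => w wu.
  by rewrite p_orth// eq_sym.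
have := cs_normE unit_proj; rewrite PP => nn.
have [->|n0] := eqVneq unit_proj 0; first by rewrite normr0.
move/eqP: nn; rewrite expr2 -{1}[`|_|]mulr1 (inj_eq (mulfI _)) ?normr_eq0//.
by move=> /eqP <-.
Qed.

End ToeplitzKMS.

(** * Weak* limits *)

Section WeakStarLimit.
Variables (R : realType) (A : cstarAlgebra R) (b : R).

Lemma cvg_real_complex (r : R -> R) (l : R) : r z @[z --> b^'+] --> l ->
  (fun z => ((r z)%:C : R[i]^o)) @ b^'+ --> (l%:C : R[i]^o).
Proof.
move=> rl; apply/cvgrPdist_lt => e e0.
have eE : e = (complex.Re e)%:C by rewrite RRe_real// ger0_real// ltW.
have d0 : 0 < complex.Re e by rewrite -ltcR -eE.
move/cvgrPdist_lt : rl => /(_ _ d0); apply: filterS => z.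
rewrite -ltcR -eE => h; apply: le_lt_trans h.
rewrite -rmorphB/= normc_def/= expr0n addr0 sqrtr_sqr; exact: lexx.
Qed.

Lemma complex_right_cvg_ext (f g : R -> R[i]^o) (l : R[i]^o) :
  (forall z, b < z -> f z = g z) -> f @ b^'+ --> l -> g @ b^'+ --> l.
Proof.
move=> fg fl; apply/cvgrPdist_lt => e e0.
move/cvgrPdist_lt : fl => /(_ _ e0) fn; near=> z.
rewrite -fg; first by near: z; exact: fn.
by near: z; exact: nbhs_right_gt.
Unshelve. all: end_near. Qed.

Variables (phi : R -> A -> R[i]) (phi0 : A -> R[i]).
Hypotheses (phi_lin : forall z, b < z -> scalar (phi z))
  (phi_le : forall z a, b < z -> `|phi z a| <= `|a|)
  (phi0_lin : scalar phi0) (phi0_le : forall a, `|phi0 a| <= `|a|).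

Lemma scalarB (f : A -> R[i]) a c : scalar f -> f (a - c) = f a - f c.
Proof.
move=> fl; have fD x y : f (x + y) = f x + f y.
  by have := fl 1 x y; rewrite scale1r mul1r.
by apply/eqP; rewrite eq_sym subr_eq -fD subrK.
Qed.

Lemma scalar_0 (f : A -> R[i]) : scalar f -> f 0 = 0.
Proof. by move=> fl; rewrite -(subrr (0 : A)) scalarB// subrr. Qed.

(** The functionals are uniformly contractive, so pointwise convergence passes to
limits in norm. *)
Lemma convergence_subspace :
  closed_subspace [set a | (fun z => (phi z a : R[i]^o)) @ b^'+ --> (phi0 a : R[i]^o)].
Proof.
split => [a acl||k a c /= la lc].
- apply/cvgrPdist_lt => e e0.
  have e3 : 0 < e / 3 by rewrite divr_gt0.
  have [c [/= lc]] : [set a | (fun z => (phi z a : R[i]^o)) @ b^'+ --> (phi0 a : R[i]^o)]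
      `&` ball a (e / 3) !=set0 by apply: acl; exact: nbhsx_ballx.
  rewrite -ball_normE/= => ac.
  move/cvgrPdist_lt : lc => /(_ _ e3) nc.
  near=> z; have bz : b < z by near: z; exact: nbhs_right_gt.
  have h1 : `|phi0 a - phi0 c| < e / 3.
    by rewrite -scalarB//; apply: (le_lt_trans (phi0_le _)).
  have h2 : `|phi z c - phi z a| < e / 3.
    by rewrite -(scalarB _ _ (phi_lin bz)) ; apply: (le_lt_trans (phi_le _ bz)); rewrite distrC.
  have h3 : `|phi0 c - phi z c| < e / 3 by near: z; exact: nc.
  have -> : phi0 a - phi z a = (phi0 a - phi0 c) + (phi0 c - phi z c) + (phi z c - phi z a).
    by ring.
  have -> : e = e / 3 + e / 3 + e / 3 by field.
  apply: (le_lt_trans (ler_normD _ _)); apply: ltrD => //.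
  by apply: (le_lt_trans (ler_normD _ _)); exact: ltrD.
- rewrite /= scalar_0//.
  apply: (@complex_right_cvg_ext (fun=> 0)); last exact: cvg_cst.
  by move=> z bz; rewrite scalar_0//; exact: phi_lin.
- rewrite phi0_lin.
  apply: (@complex_right_cvg_ext (fun z => k * phi z a + phi z c)).
    by move=> z bz; rewrite phi_lin.
  exact: (cvgD (cvgM (cvg_cst (k : R[i]^o)) la) lc).
Unshelve. all: end_near. Qed.

End WeakStarLimit.

Theorem theorem25 (R : realType) (E : digraph)
    (A : cstarAlgebra R) (p : vert E -> A) (s : edge E -> A)
    (hA : is_toeplitz_algebra p s)
    (alpha : R -> A -> A) (halpha : is_gauge_action p s alpha)
    (v : vert E) (hv : (0 < beta_crit R v)%E)
    (C0 : {set vert E}) (hC0 : C0 \in components E) (hvC0 : v \in C0)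
    (phi : R -> A -> R[i])
    (hphi : forall beta : R, 0 < beta -> (beta_crit R v < beta%:E)%E ->
              is_typeI_state p alpha v beta (phi beta))
    (psi : {set vert E} -> A -> R[i])
    (hpsi : forall C, C \in pi_mc R E -> is_psi p s alpha C (psi C)) :
  exists phi_v : A -> R[i],
    [/\ is_state phi_v,
        weakstar_right_limit phi (fine (beta_crit R v)) phi_v,
        exists lam : {set vert E} -> R, convex_decomposition v psi phi_v lam
      & forall lam : {set vert E} -> R, convex_decomposition v psi phi_v lam ->
          forall C : {set vert E}, C \in pi_v_mc R v ->
            (0 < lam C <->
             exists mu : fpath (Bgraph C0),
               Bpaths C mu /\ maximal_path R v mu)].
Proof.
have [fam gen _] := hA.
have [b bE] : exists b : R, beta_crit R v = b%:E.
  have [g Zg] := Zfun_fin_large R v.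
  have : (beta_crit R v <= g%:E)%E by apply: ereal_inf_lbound; exists g.
  by case: (beta_crit R v) hv => [r _ _|//|//]; exists r.
have b0 : 0 < b by rewrite -lte_fin -bE.
have [x [xlim [x0 x1] x_harm x_conn x_max]] := limit_vector bE hC0 hvC0.
pose P := pi_v_mc R v.
have Pcomp C : C \in P -> beta_comp R C = b.
  by move=> pC; have [_ rC _ _] := pi_v_mcP b0 bE _ pC; rewrite /beta_comp rC expRK.
have Ppsi C : C \in P -> is_psi p s alpha C (psi C).
  by move=> pC; apply: hpsi; move: pC; rewrite finset.in_set => /andP[].
have Pkms C : C \in P -> is_KMS_state alpha b (psi C).
  by move=> pC; have [K _ _] := Ppsi C pC; rewrite (Pcomp C pC) in K.
pose X C w := complex.Re (psi C (p w)).
have XE C w : C \in P -> psi C (p w) = (X C w)%:C.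
  by move=> /Ppsi[_ _ [chi _ hchi]]; rewrite /X hchi.
have X_ge0 C : C \in P -> forall w, 0 <= X C w.
  move=> pC w; have := kms_pos (Pkms C pC) (p w).
  by rewrite (p_star fam) (p_idem fam) XE// ler0c.
have X_harm C : C \in P -> harmonic (expR b) (X C).
  move=> pC w; have [_ /(_ w) gap0 _] := Ppsi C pC.
  move: gap0; rewrite (kms_gap fam halpha w (Pkms C pC)) => /eqP.
  rewrite subr_eq0 XE// => /eqP.
  rewrite (eq_bigr (fun e => (X C (rng e))%:C)) => [|e _]; last exact: XE.
  rewrite -rmorph_sum -rmorphM/= => /complexI ->; rewrite kernel_app_edges.
  by rewrite mulrA -expRD subrr expR0 mul1r.
have X_chi C : C \in P -> exists2 chi : vert E -> R, is_chi C chi &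
    forall w, X C w = chi w / \sum_u `|chi u|.
  move=> /Ppsi[_ _ [chi hchi hX]]; exists chi => // w.
  by rewrite /X hX.
have chi_sum C (chi : vert E -> R) : C \in P -> is_chi C chi -> 0 < \sum_u `|chi u|.
  move=> pC [chi0 _ _ _]; have [cC _ _ _] := pi_v_mcP b0 bE _ pC.
  have [w wC] := comp_neq0 cC.
  by rewrite (bigD1 w)//= ltr_wpDr ?sumr_ge0// normr_gt0 gt_eqF// chi0.
have X_gt0 C : C \in P -> forall w, w \in C -> 0 < X C w.
  move=> pC w wC; have [chi hchi ->] := X_chi C pC.
  apply: divr_gt0; last exact: chi_sum pC hchi.
  by have [h _ _ _] := hchi; exact: h.
have X_supp C : C \in P -> forall w, X C w != 0 ->
    exists2 u, u \in C & conn w u.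
  move=> pC w; have [chi hchi ->] := X_chi C pC; move=> Xw.
  have [_ _ _ chi0] := hchi.
  have [wC|wC] := boolP (w \in C); first by exists w => //; exact: connect0.
  have [|wD] := boolP (w \in strict_ancestors C).
    rewrite finset.in_set => /andP[_ /reachP[y [u [/eqP -> uC yu]]]].
    by exists u.
  by rewrite chi0// mul0r eqxx in Xw.
have X_sum C : C \in P -> \sum_w X C w = 1.
  move=> pC; have [chi hchi hX] := X_chi C pC.
  have S0 := chi_sum C chi pC hchi.
  rewrite (eq_bigr (fun w => `|chi w| / \sum_u `|chi u|)) => [|w _].
    by rewrite -mulr_suml divff// gt_eqF.
  rewrite hX ger0_norm// -(pmulr_lge0 _ (_ : 0 < (\sum_u `|chi u|)^-1)) ?invr_gt0//.
  by rewrite -hX X_ge0.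
have [c [c0 xc]] := harmonic_decomposition b0 bE x0 x_harm x_conn X_ge0 X_harm X_gt0 X_supp.
have c1 : \sum_(C in P) c C = 1.
  rewrite -x1 (eq_bigr (fun w => \sum_(C in P) c C * X C w)) => [|w _]; last exact: xc.
  rewrite exchange_big/=; apply: eq_bigr => C pC.
  by rewrite -mulr_sumr X_sum// mulr1.
pose phi_v a := \sum_(C in P) (c C)%:C * psi C a.
have phi_v_lin : scalar phi_v.
  move=> k a d; rewrite /phi_v mulr_sumr -big_split/=; apply: eq_bigr => C pC.
  by rewrite (kms_linear (Pkms C pC)) mulrDr mulrCA.
have phi_v_le a : `|phi_v a| <= `|a|.
  apply: (le_trans (ler_norm_sum _ _ _)).
  apply: (@le_trans _ _ (\sum_(C in P) (c C)%:C * `|a|)).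
    apply: ler_sum => C pC; rewrite normrM ger0_norm ?ler0c ?c0//.
    by rewrite ler_wpM2l ?ler0c ?c0// (kms_state_norm _ (Pkms C pC)).
  by rewrite -mulr_suml -rmorph_sum/= c1 mul1r.
have phi_v_p w : phi_v (p w) = (x w)%:C.
  rewrite xc rmorph_sum/=; apply: eq_bigr => C pC.
  by rewrite XE// -rmorphM.
have hphi' z : b < z -> is_typeI_state p alpha v z (phi z).
  by move=> bz; apply: hphi; [exact: lt_trans bz|rewrite bE lte_fin].
exists phi_v; split.
- split => //.
    move=> a; apply: sumr_ge0 => C pC.
    by rewrite mulr_ge0 ?ler0c ?c0// (kms_pos (Pkms C pC)).
  split => // eps eps0; exists (unit_proj p); first exact: norm_unit_proj fam.
  have -> : phi_v (unit_proj p) = 1.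
    have phiD a d : phi_v (a + d) = phi_v a + phi_v d.
      by have := phi_v_lin 1 a d; rewrite scale1r mul1r.
    rewrite /unit_proj (big_morph phi_v phiD (scalar_0 phi_v_lin)).
    rewrite (eq_bigr (fun w => (x w)%:C)) => [|w _]; last exact: phi_v_p.
    by rewrite -rmorph_sum/= x1.
  by rewrite normr1 ltrBlDr ltrDl ltcR.
- rewrite bE /= => a.
  have sub := @convergence_subspace R A b phi phi_v
    (fun z bz => kms_linear (hphi' z bz).1)
    (fun z a bz => kms_state_norm a (hphi' z bz).1) phi_v_lin phi_v_le.
  (* by density it is enough to treat monomials and elements killed by all KMS
     states *)
  have ca : cspan (monomial p s `|` kms_null alpha) a.
    by rewrite (cspan_monomial fam halpha gen).
  apply: (cspan_min sub _ ca) => m [mm|Jm] /=; last first.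
    have -> : phi_v m = 0.
      by apply: big1 => C pC; rewrite (Jm _ _ b0 (Pkms C pC)).1 mulr0.
    apply: (@complex_right_cvg_ext _ b (fun=> 0)); last exact: cvg_cst.
    by move=> z bz; rewrite (Jm _ _ (lt_trans b0 bz) (hphi' z bz).1).1.
  have [mu [nu [u ->]]] := monomial_word fam mm.
  have [opt ho] := word_value fam halpha mu nu u.
  pose val (op : option (nat * vert E)) z (y : vert E -> R) : R :=
    if op is Some (n, w) then expR (- z * n%:R) * y w else 0.
  have hv0 : phi_v (word p s mu nu u) = (val opt b x)%:C.
    rewrite /phi_v /val; case: opt ho => [[n w]|] ho; last first.
      by apply: big1 => C pC; rewrite (ho _ _ b0 (Pkms C pC)) mulr0.
    rewrite rmorphM/= -phi_v_p /phi_v mulr_sumr; apply: eq_bigr => C pC.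
    by rewrite (ho _ _ b0 (Pkms C pC)) mulrCA.
  have hvz z : b < z -> phi z (word p s mu nu u) =
      (val opt z (fun w => fine (Zfun2 w v z) / fine (Zfun v z)))%:C.
    move=> bz; have [K hp] := hphi' z bz; rewrite (ho _ _ (lt_trans b0 bz) K) /val.
    by clear hv0; case: opt ho => [[n w]|] _ //; rewrite hp -rmorphM.
  rewrite hv0.
  apply: (@complex_right_cvg_ext _ b
    (fun z => (val opt z (fun w => fine (Zfun2 w v z) / fine (Zfun v z)))%:C)).
    by move=> z bz; rewrite hvz.
  apply: cvg_real_complex; rewrite /val; case: opt {ho hv0 hvz} => [[n w]|]; last exact: cvg_cst.
  apply: cvgM; last exact: xlim.
  under eq_fun do rewrite expRM_natr; rewrite expRM_natr.
  elim: n => [|n IH]; first by under eq_fun do rewrite expr0; rewrite expr0; exact: cvg_cst.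
  by under eq_fun do rewrite exprS; rewrite exprS; apply: cvgM IH; exact: expRN_cvg.
- by exists c; split.
move=> lam [lam0 lam1 lamE] C pC.
have [cC _ _ rv] := pi_v_mcP b0 bE _ pC.
have [w wC] := comp_neq0 cC.
have wv : conn w v.
  by have [u /eqP -> ] := reach_comp cC wC rv.
(* On C the vectors of the other components vanish, so the coefficient at C is a
   positive multiple of the entries of x on C, whatever the decomposition. *)
rewrite -(x_max C w cC wC wv).
suff -> : x w = lam C * X C w by rewrite pmulr_lgt0 ?(X_gt0 C pC).
rewrite -(sum_on_component b0 bE X_supp lam pC wC).
apply: complexI; rewrite -phi_v_p lamE rmorph_sum/=; apply: eq_bigr => C' pC'.
by rewrite XE// -rmorphM.
Qed.
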